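(* Let $\mathcal{G}$ be a connected undirected graph on $\mathcal{I}=\{1,\dots,n\}$ with neighbor sets $N_i$, let $\mathcal{I}_c\subset\mathcal{I}$, and let $f_1,\dots,f_n:\mathbb{R}^3\to\mathbb{R}^3$ be such that (a) for $i\in\mathcal{I}_c$, $f_i$ is locally Lipschitz continuous, $f_i(\mathbf{0})=\mathbf{0}$, and $f_i(y)^\top y=\|f_i(y)\|\,\|y\|\neq 0$ for all $y\neq\mathbf{0}$; (b) for $i\in\mathcal{I}\setminus\mathcal{I}_c$, $f_i=\operatorname{sign}$ (the direction-preserving signum). Consider the multi-agent system $$\dot x_i=L_{x_i}\,f_i\Big(\sum_{j\in N_i}(x_j-x_i)\Big),\qquad i\in\mathcal{I},$$ with $x=[x_1^\top,\dots,x_n^\top]^\top\in\mathbb{R}^{3n}$, and the corresponding differential inclusion $\dot x\in\mathcal{F}[g](x)$, where $g(x)$ denotes the right-hand side of the system. Assume that the initial rotations satisfy $R_i(0)\in B_\pi(I)\subset SO(3)$ for all $i\in\mathcal{I}$, i.e. $\|x_i(0)\|<\pi$ for all $i\in\mathcal{I}$. Then all (maximal) Filippov solutions converge to consensus in finite time if one of the following conditions holds: (i) $|\mathcal{I}|>2$ and $|\mathcal{I}_c|=1$; (ii) $|\mathcal{I}|=2$ and $|\mathcal{I}_c|\leq 1$.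
   Context: $\|\cdot\|$ is the Euclidean norm. $N_i$ is the set of neighbors of node $i$ in $\mathcal{G}$ (unit edge weights, no self-loops). Direction-preserving signum: $\operatorname{sign}(w)=w/\|w\|$ if $w\neq\mathbf{0}$ and $\operatorname{sign}(\mathbf{0})=\mathbf{0}$. For $p=[p_1,p_2,p_3]^\top\in\mathbb{R}^3$, $\hat p=\begin{pmatrix}0&-p_3&p_2\\ p_3&0&-p_1\\ -p_2&p_1&0\end{pmatrix}$. For $p\in\mathbb{R}^3$ with $0<\|p\|<2\pi$, $$L_p=\frac{\operatorname{sinc}(\|p\|)}{\operatorname{sinc}^2(\|p\|/2)}I_3+\Big(1-\frac{\operatorname{sinc}(\|p\|)}{\operatorname{sinc}^2(\|p\|/2)}\Big)\frac{pp^\top}{\|p\|^2}+\frac{\hat p}{2},$$ and $L_{\mathbf{0}}=I_3$, where $\operatorname{sinc}(\alpha)=\sin(\alpha)/\alpha$ for $\alpha\ne0$ and $\operatorname{sinc}(0)=1$. Rotations: $R_i(t)\in SO(3)$ is the attitude of agent $i$ and $x_i(t)\in\mathbb{R}^3$ its axis-angle representation, $\hat x_i(t)=\log R_i(t)$, equivalently $R_i=\exp(\hat x_i)$ with $\|x_i\|<\pi$. $B_\pi(I)\subset SO(3)$ is the open ball of radius $\pi$ around the identity for the metric $d_R(R_1,R_2)=\frac{1}{\sqrt2}\|\log(R_1^{-1}R_2)\|_F$; it is diffeomorphic to $\{p\in\mathbb{R}^3:\|p\|<\pi\}$ via $p\mapsto\exp(\hat p)$. Filippov set-valued map of $g$: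 $\mathcal{F}[g](x)=\bigcap_{\delta>0}\bigcap_{\mu(S)=0}\overline{\mathrm{co}}\{g(B(x,\delta)\setminus S)\}$, where $\mu$ is Lebesgue measure, $B(x,\delta)$ is the ball of radius $\delta$ centered at $x$, and $\overline{\mathrm{co}}$ is the closed convex hull. A Filippov solution is an absolutely continuous function $x(t)$ satisfying $\dot x(t)\in\mathcal{F}[g](x(t))$ for almost all $t$; it is maximal if it cannot be extended forward in time. Convergence to consensus in finite time means: there exist $T>0$ and $\bar R\in SO(3)$ such that $R_i(t)\to\bar R$ as $t\to T$ for all $i\in\mathcal{I}$; equivalently, $x(t)$ reaches in finite time the consensus space $\mathcal{C}=\{x\in\mathbb{R}^{3n}\mid\exists\,\bar x\in\mathbb{R}^3: x_i=\bar x \text{ for all } i\in\mathcal{I}\}$. *)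

(* Defs.v *)
From HB Require Import structures.
From mathcomp Require Import all_boot all_order all_algebra.
From mathcomp Require Import all_classical all_reals all_analysis.

Set Implicit Arguments.
Unset Strict Implicit.
Unset Printing Implicit Defensive.

Import Order.TTheory GRing.Theory Num.Theory.
Import numFieldNormedType.Exports.

Local Open Scope classical_set_scope.
Local Open Scope ring_scope.

Section Euclidean.
Context {R : realType}.

(* The library norm `|A| is the max norm; enorm is the Euclidean
   norm of the vector of all entries of A. *)
Definition enorm m n (A : 'M[R]_(m, n)) : R :=
  Num.sqrt (\sum_i \sum_j A i j ^+ 2).

Definition eball m n (A : 'M[R]_(m, n)) (d : R) : set 'M[R]_(m, n) :=
  [set B | enorm (B - A) < d].

Definition dotv m (u v : 'cV[R]_m) : R := (u^T *m v) 0 0.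

Definition dsign m (w : 'cV[R]_m) : 'cV[R]_m :=
  if w == 0 then 0 else (enorm w)^-1 *: w.

(* All norms on 'cV[R]_m being equivalent, the max norm underlying the
   library's lipschitz gives the usual notion. *)
Definition locally_lipschitz m (h : 'cV[R]_m -> 'cV[R]_m) : Prop :=
  forall y : 'cV[R]_m, exists2 U, nbhs y U & [lipschitz h z | z in U].

End Euclidean.

Section Rotations.
Context {R : realType}.
Implicit Types p : 'cV[R]_3.

Definition sinc (a : R) : R := if a == 0 then 1 else sin a / a.

Definition hat p : 'M[R]_3 :=
  \matrix_(i < 3, j < 3)
    nth 0 (nth [::] [:: [::      0 ; - p 2 0 ;   p 1 0];
                        [::  p 2 0 ;       0 ; - p 0 0];
                        [:: - p 1 0;   p 0 0 ;      0 ]] i) j.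

(* Meaningful for enorm p < 2 * pi; a junk value otherwise. *)
Definition Lmx p : 'M[R]_3 :=
  if p == 0 then 1%:M else
    let c := sinc (enorm p) / sinc (enorm p / 2) ^+ 2 in
    c%:M + ((1 - c) / enorm p ^+ 2) *: (p *m p^T) + 2^-1 *: hat p.

Definition expmx (A : 'M[R]_3) : 'M[R]_3 :=
  lim (series (fun k => (k`!%:R)^-1 *: A ^+ k) @ \oo).

Definition SO3 : set 'M[R]_3 := [set A | A *m A^T = 1%:M /\ \det A = 1].

End Rotations.

Section Filippov.
Context {R : realType} {m n : nat}.
Implicit Types (S D : set 'M[R]_(m, n)).

(* Lebesgue outer measure zero in R^(m * n). *)
Definition lebesgue_null S : Prop :=
  forall eps : R, 0 < eps ->
  exists a b : nat -> 'M[R]_(m, n),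
    [/\ forall k i j, a k i j <= b k i j,
        S `<=` \bigcup_k [set x : 'M[R]_(m, n) |
                             forall i j, a k i j <= x i j <= b k i j] &
        (\sum_(0 <= k <oo) (\prod_i \prod_j (b k i j - a k i j))%:E
           <= eps%:E)%E].

Definition closed_convex_hull S : set 'M[R]_(m, n) :=
  smallest (fun B : set 'M[R]_(m, n) =>
              closed B /\ @convex_set R 'M[R]_(m, n) B) S.

Definition filippov (g : 'M[R]_(m, n) -> 'M[R]_(m, n)) (x : 'M[R]_(m, n)) :
    set 'M[R]_(m, n) :=
  \bigcap_(d in [set d : R | 0 < d]) \bigcap_(S in lebesgue_null)
    closed_convex_hull (g @` (eball x d `\` S)).

Definition absolutely_continuous_on (a b : R) (x : R -> 'M[R]_(m, n)) : Prop :=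
  forall eps : R, 0 < eps -> exists2 delta : R, 0 < delta &
  forall s : seq (R * R),
    all (fun u => (a <= u.1) && (u.1 <= u.2) && (u.2 <= b)) s ->
    pairwise (fun u v => (u.2 <= v.1) || (v.2 <= u.1)) s ->
    \sum_(u <- s) (u.2 - u.1) < delta ->
    \sum_(u <- s) enorm (x u.2 - x u.1) < eps.

(* An interval [0, a], [0, a) or [0, +oo) with a > 0. *)
Definition time_interval (J : set R) : Prop :=
  [/\ is_interval J, J 0, J `<=` [set t | 0 <= t] & exists2 t, J t & 0 < t].

(* D is an open set on which the vector field g is defined.  For x in D the set
   filippov g x does not depend on the values of g outside D, since d can be
   taken arbitrarily small.  Values of x outside the time interval J are
   irrelevant. *)
Definition filippov_solution D (g : 'M[R]_(m, n) -> 'M[R]_(m, n))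
    (J : set R) (x : R -> 'M[R]_(m, n)) : Prop :=
  [/\ time_interval J,
      forall t, J t -> D (x t),
      forall b, J b -> absolutely_continuous_on 0 b x &
      {ae @lebesgue_measure R, forall t, J t ->
         derivable x t 1 /\ filippov g (x t) ('D_1 x t)}].

Definition maximal_filippov_solution D (g : 'M[R]_(m, n) -> 'M[R]_(m, n))
    (J : set R) (x : R -> 'M[R]_(m, n)) : Prop :=
  filippov_solution D g J x /\
  forall (J' : set R) (x' : R -> 'M[R]_(m, n)),
    filippov_solution D g J' x' -> J `<=` J' ->
    (forall t, J t -> x' t = x t) -> J' = J.

End Filippov.

Section System.
Context {R : realType} {n : nat}.

(* The state x = (x_1, ..., x_n) of R^(3n) is the 3 x n matrix whose i-th
   column is x_i. *)

Definition neighbors (e : rel 'I_n) (i : 'I_n) : {set 'I_n} := [set j | e i j].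

(* The set where all the L_(x_i) are defined; that solutions starting with
   |x_i| < pi keep |x_i| < pi is not built in. *)
Definition state_domain : set 'M[R]_(3, n) :=
  [set x | forall i, enorm (col i x) < 2 * pi].

Definition attitude_field (e : rel 'I_n) (f : 'I_n -> 'cV[R]_3 -> 'cV[R]_3)
    (x : 'M[R]_(3, n)) : 'M[R]_(3, n) :=
  \matrix_(k < 3, i < n)
    (Lmx (col i x) *m
       f i (\sum_(j in neighbors e i) (col j x - col i x))) k 0.

Definition rotation (x : R -> 'M[R]_(3, n)) (i : 'I_n) (t : R) : 'M[R]_3 :=
  expmx (hat (col i (x t))).

Definition consensus_space : set 'M[R]_(3, n) :=
  [set x | exists xbar : 'cV[R]_3, forall i, col i x = xbar].

(* Convergence of the rotations and x T in the consensus space are equivalent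
   as long as |x_i| < pi; both are required. *)
Definition finite_time_consensus (J : set R) (x : R -> 'M[R]_(3, n)) : Prop :=
  exists T : R,
    [/\ 0 < T, J T,
        exists2 Rbar, SO3 Rbar &
          forall i, rotation x i t @[t --> T^'-] --> Rbar &
        consensus_space (x T)].

End System.

(* Main.v *)
From HB Require Import structures.
Require Import Defs.
From mathcomp Require Import all_boot all_order all_algebra.
From mathcomp Require Import all_classical all_reals all_analysis.
From mathcomp Require Import measurable_realfun ring lra.
Set Implicit Arguments.
Unset Strict Implicit.
Unset Printing Implicit Defensive.

Import Order.TTheory GRing.Theory Num.Theory.
Import numFieldNormedType.Exports.

Local Open Scope classical_set_scope.
Local Open Scope ring_scope.

(** Write x_i for the columns of the state and pull_i for the sum of x_j - x_i
    over the neighbors j of i.  Two functions decrease along every Filippov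
    solution that starts in the region |x_i| < pi and is not at consensus.

    The largest norm |x_i| does not increase: off consensus some outermost agent
    has a neighbor elsewhere, its velocity points strictly inwards, and L_p does
    not change the component along p (field_inward).  So |x_i| <= rho0 < pi at
    all times, and the symmetric part of L_(x_i) is bounded below by a positive
    constant c (frob_Lmx_ge).

    The disagreement is the square root of the sum of |x_i - x_j|^2 over the
    edges.  The gradient of its square is proportional to the pulls, and
    pull_i . L f_i (pull_i) is nonnegative for all agents and at least
    c |pull_i| for those with f_i = sign.  All agents but at most one are of
    this kind and the pulls add up to zero, so the sum of these terms is at
    least (c / 2) times the sum of the |pull_i|, hence at least a constant times
    the disagreement itself, since the graph is connected.  Therefore the
    disagreement decreases at a rate bounded away from zero (field_dissipates),
    and it can do so only for a bounded time.

    Both functions are convex and Lipschitz, and subgradient_decrease turns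
    bounds on one subgradient at almost every time into monotonicity along an
    absolutely continuous curve.  The bounds hold for all velocities in a
    Filippov set because this set lies in every closed half-space that contains
    the values of the field nearby (filippov_le).

    It remains to exclude that a maximal solution ends before consensus.  Such a
    solution would be Lipschitz on a bounded interval, would have an end value,
    and could be continued from there (solution_extends).  The continuation is
    an ultrafilter limit of Euler approximations (filippov_local_existence); it
    is Lipschitz, hence differentiable almost everywhere
    (lipschitz_derivable_ae).

    At consensus, the rotations converge by continuity of the exponential map,
    which Rodrigues' formula makes explicit (expmx_hat, cvg_rodrigues). *)


(** * The Euclidean norm of matrices *)

Section LipschitzContinuous.
Context {R : realType}.

Lemma lipschitz_continuous {V W : normedModType R} (h : V -> W) (K : R) :
  (forall x y, `|h x - h y| <= K * `|x - y|) -> continuous h.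
Proof.
move=> hK x; apply/cvgrPdist_le => e e0; near=> y.
have K1 : 0 < `|K| + 1 by rewrite ltr_wpDl.
have xy : `|x - y| < e / (`|K| + 1).
  by near: y; apply: cvgr_dist_lt => //; rewrite divr_gt0.
rewrite (le_trans (hK x y))// (le_trans (ler_norm _))// normrM normr_id.
move: xy; rewrite ltr_pdivlMr// => xy.
by have := normr_ge0 (x - y); nra.
Unshelve. all: by end_near. Qed.

Lemma lipschitz_continuousR {V : normedModType R} (h : V -> R) (K : R) :
  (forall x y, h x - h y <= K * `|x - y|) -> continuous h.
Proof.
move=> hK; apply: (@lipschitz_continuous _ _ _ K) => x y.
by rewrite ler_norml lerNl opprB hK distrC hK.
Qed.

End LipschitzContinuous.

Section FrobeniusProduct.
Context {R : realType} {m n : nat}.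
Implicit Types A B C : 'M[R]_(m, n).

Definition frob A B : R := \sum_i \sum_j A i j * B i j.

Lemma frobC A B : frob A B = frob B A.
Proof. by apply: eq_bigr => i _; apply: eq_bigr => j _; rewrite mulrC. Qed.

Lemma frobDr A B C : frob A (B + C) = frob A B + frob A C.
Proof.
rewrite -big_split; apply: eq_bigr => i _; rewrite -big_split.
by apply: eq_bigr => j _; rewrite mxE mulrDr.
Qed.

Lemma frobZr A (k : R) B : frob A (k *: B) = k * frob A B.
Proof.
rewrite mulr_sumr; apply: eq_bigr => i _; rewrite mulr_sumr.
by apply: eq_bigr => j _; rewrite mxE mulrCA.
Qed.

Lemma frobNr A B : frob A (- B) = - frob A B.
Proof. by rewrite -scaleN1r frobZr mulN1r. Qed.

Lemma frobBr A B C : frob A (B - C) = frob A B - frob A C.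
Proof. by rewrite frobDr frobNr. Qed.

Lemma frobDl A B C : frob (A + B) C = frob A C + frob B C.
Proof. by rewrite frobC frobDr !(frobC C). Qed.

Lemma frobZl A (k : R) B : frob (k *: A) B = k * frob A B.
Proof. by rewrite frobC frobZr frobC. Qed.

Lemma frobBl A B C : frob (A - B) C = frob A C - frob B C.
Proof. by rewrite frobC frobBr !(frobC C). Qed.

Lemma frob0r A : frob A 0 = 0.
Proof. by rewrite -(scale0r A) frobZr mul0r. Qed.

Lemma frob0l A : frob 0 A = 0. Proof. by rewrite frobC frob0r. Qed.

Lemma frob_ge0 A : 0 <= frob A A.
Proof.
by apply: sumr_ge0 => i _; apply: sumr_ge0 => j _; rewrite -expr2 sqr_ge0.
Qed.

Lemma enormE A : enorm A = Num.sqrt (frob A A).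
Proof.
by congr Num.sqrt; apply: eq_bigr => i _; apply: eq_bigr => j _; rewrite expr2.
Qed.

Lemma enorm_ge0 A : 0 <= enorm A. Proof. exact: sqrtr_ge0. Qed.

Lemma enorm_sqr A : enorm A ^+ 2 = frob A A.
Proof. by rewrite enormE sqr_sqrtr// frob_ge0. Qed.

Lemma ler_entry_enorm A i j : `|A i j| <= enorm A.
Proof.
rewrite -(@ler_pXn2r _ 2)// ?nnegrE ?enorm_ge0// enorm_sqr /frob.
rewrite (bigD1 i)//= (bigD1 j)//= -addrA -normrX ger0_norm ?sqr_ge0// -expr2.
rewrite lerDl addr_ge0//.
  by apply: sumr_ge0 => k _; rewrite -expr2 sqr_ge0.
by apply: sumr_ge0 => k _; apply: sumr_ge0 => l _; rewrite -expr2 sqr_ge0.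
Qed.

Lemma enorm_eq0 A : (enorm A == 0) = (A == 0).
Proof.
apply/eqP/eqP => [A0|->]; last by rewrite enormE frob0r sqrtr0.
apply/matrixP => i j; rewrite mxE; apply/eqP.
by rewrite -normr_le0 -A0 ler_entry_enorm.
Qed.

Lemma enorm0 : enorm (0 : 'M[R]_(m, n)) = 0.
Proof. by apply/eqP; rewrite enorm_eq0. Qed.

Lemma enorm_gt0 A : (0 < enorm A) = (A != 0).
Proof. by rewrite lt_def enorm_eq0 enorm_ge0 andbT. Qed.

Lemma enormZ (k : R) A : enorm (k *: A) = `|k| * enorm A.
Proof.
rewrite !enormE frobZl frobZr mulrA -expr2 sqrtrM ?sqr_ge0//.
by rewrite sqrtr_sqr.
Qed.

Lemma enormN A : enorm (- A) = enorm A.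
Proof. by rewrite -scaleN1r enormZ normrN1 mul1r. Qed.

Lemma enorm_distC A B : enorm (A - B) = enorm (B - A).
Proof. by rewrite -enormN opprB. Qed.

(** Expanding 0 <= | |B| A - |A| B |^2 gives the Cauchy-Schwarz inequality.
    *)
Lemma frob_le_enorm A B : frob A B <= enorm A * enorm B.
Proof.
have [->|A0] := eqVneq A 0; first by rewrite frob0l mulr_ge0 ?enorm_ge0.
have [->|B0] := eqVneq B 0; first by rewrite frob0r mulr_ge0 ?enorm_ge0.
have ab0 : 0 < enorm A * enorm B by rewrite mulr_gt0 ?enorm_gt0.
have := frob_ge0 (enorm B *: A - enorm A *: B).
rewrite frobBl !frobBr !frobZl !frobZr -!enorm_sqr (frobC B) => h.
by rewrite -(ler_pM2l ab0); nra.
Qed.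

Lemma normr_frob_le A B : `|frob A B| <= enorm A * enorm B.
Proof.
rewrite ler_norml frob_le_enorm andbT lerNl -frobNr.
by rewrite -(enormN B) frob_le_enorm.
Qed.

Lemma ler_enormD A B : enorm (A + B) <= enorm A + enorm B.
Proof.
rewrite -(@ler_pXn2r _ 2)// ?nnegrE ?addr_ge0 ?enorm_ge0//.
rewrite sqrrD !enorm_sqr frobDl !frobDr (frobC B A).
have := frob_le_enorm A B; lra.
Qed.

Lemma ler_enormB A B : enorm (A - B) <= enorm A + enorm B.
Proof. by rewrite (le_trans (ler_enormD _ _))// enormN. Qed.

Lemma ler_dist_enorm A B : enorm A - enorm B <= enorm (A - B).
Proof. by rewrite lerBlDr -{1}(subrK B A) ler_enormD. Qed.

(** Cauchy-Schwarz in subgradient form. Along a curve, it bounds the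
    decrease of the norm to the past by a linear functional of the velocity.
    *)
Lemma enorm_subgradient A B : enorm A != 0 ->
  enorm A + frob ((enorm A)^-1 *: A) (B - A) <= enorm B.
Proof.
rewrite enorm_eq0 -enorm_gt0 => A0; rewrite frobZl frobBr -enorm_sqr.
rewrite mulrBr expr2 mulKf ?gt_eqF// addrC subrK ler_pdivrMl//.
exact: frob_le_enorm.
Qed.

Lemma normr_entry_le A i j : `|A i j| <= `|A|.
Proof.
rewrite [leRHS]/Num.Def.normr/= mx_normrE.
exact: (le_bigmax _ (fun ij => `|A ij.1 ij.2|) (i, j)).
Qed.

Lemma mxnorm_le A (e : R) : 0 <= e -> (forall i j, `|A i j| <= e) -> `|A| <= e.
Proof.
by move=> e0 h; rewrite [leLHS]/Num.Def.normr/= mx_normrE bigmax_le.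
Qed.

Lemma mxnorm_lt A (e : R) : 0 < e -> (forall i j, `|A i j| < e) -> `|A| < e.
Proof.
by move=> e0 h; rewrite [ltLHS]/Num.Def.normr/= mx_normrE bigmax_lt.
Qed.

Lemma mxnorm_le_enorm A : `|A| <= enorm A.
Proof. by apply: mxnorm_le => [|i j]; rewrite ?enorm_ge0 ?ler_entry_enorm. Qed.

Lemma enorm_le_mxnorm A : enorm A <= (m * n).+1%:R * `|A|.
Proof.
rewrite -(@ler_pXn2r _ 2)// ?nnegrE ?mulr_ge0 ?enorm_ge0// enorm_sqr.
apply: (@le_trans _ _ (\sum_(i < m) \sum_(j < n) `|A| ^+ 2)).
  apply: ler_sum => i _; apply: ler_sum => j _.
  by rewrite -expr2 -real_normK ?num_real// lerXn2r ?nnegrE// normr_entry_le.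
rewrite !sumr_const !card_ord -mulrnA exprMn -[leLHS]mulr_natl.
apply: ler_wpM2r; first exact: sqr_ge0.
by rewrite -natrX ler_nat mulnC expnS expn1 mulSn (leq_trans (leqnSn _)) ?leq_addr.
Qed.

Lemma continuous_entry i j : continuous (fun A : 'M[R]_(m, n) => A i j).
Proof.
apply: (@lipschitz_continuousR _ _ _ 1) => A B; rewrite mul1r.
apply: le_trans (normr_entry_le (A - B) i j); rewrite !mxE; exact: ler_norm.
Qed.

(** Limits in the max norm may be taken entrywise, along any filter. *)
Lemma cvg_mx (T : Type) (F : set_system T) (X : T -> 'M[R]_(m, n)) (l : 'M[R]_(m, n)) :
  Filter F -> (forall i j, (fun k => X k i j) @ F --> l i j) -> X @ F --> l.
Proof.
move=> FF Xl; apply/cvgrPdist_lt => e e0.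
suff : \forall k \near F, forall ij : 'I_m * 'I_n, `|l ij.1 ij.2 - X k ij.1 ij.2| < e.
  apply: filterS => k hk; apply: mxnorm_lt => // i j; rewrite !mxE.
  exact: (hk (i, j)).
apply: filter_forall => -[i j] /=.
by move/cvgrPdist_lt : (Xl i j) => /(_ _ e0).
Qed.

Lemma continuous_enorm : continuous (@enorm R m n).
Proof.
apply: (@lipschitz_continuousR _ _ _ (m * n).+1%:R) => A B.
exact: le_trans (ler_dist_enorm A B) (enorm_le_mxnorm _).
Qed.

Lemma continuous_frob A : continuous (frob A).
Proof.
apply: (@lipschitz_continuousR _ _ _ (enorm A * (m * n).+1%:R)) => B C.
rewrite -frobBr (le_trans (frob_le_enorm _ _))// -mulrA.
by rewrite ler_wpM2l ?enorm_ge0 ?enorm_le_mxnorm.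
Qed.

Lemma enorm_ball_nbhs (A : 'M[R]_(m, n)) (d : R) : 0 < d -> nbhs A (eball A d).
Proof.
move=> d0; apply/nbhs_ballP; exists (d / (m * n).+1%:R) => /=.
  by rewrite divr_gt0.
move=> B; rewrite -ball_normE/= /eball/= enorm_distC ltr_pdivlMr// mulrC.
exact: le_lt_trans (enorm_le_mxnorm _).
Qed.

Lemma nbhs_eball (A : 'M[R]_(m, n)) (U : set 'M[R]_(m, n)) : nbhs A U ->
  exists2 d : R, 0 < d & eball A d `<=` U.
Proof.
move=> /nbhs_ballP[d /= d0 AU]; exists d => // B; rewrite /eball/= => AB.
apply: AU; rewrite -ball_normE/= distrC.
exact: le_lt_trans (mxnorm_le_enorm _) AB.
Qed.

End FrobeniusProduct.

Section ColumnNorm.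
Context {R : realType} {m n : nat}.
Implicit Types A B : 'M[R]_(m, n).

Lemma frob_colE A B : frob A B = \sum_j frob (col j A) (col j B).
Proof.
rewrite /frob exchange_big/=; apply: eq_bigr => j _; apply: eq_bigr => i _.
by rewrite big_ord1 !mxE.
Qed.

Lemma dotvE (u v : 'cV[R]_m) : dotv u v = frob u v.
Proof.
rewrite /dotv mxE; apply: eq_bigr => i _; by rewrite big_ord1 !mxE.
Qed.

Lemma enorm_col_le A j : enorm (col j A) <= enorm A.
Proof.
rewrite -(@ler_pXn2r _ 2)// ?nnegrE ?enorm_ge0// !enorm_sqr frob_colE.
rewrite (bigD1 j)//= lerDl; apply: sumr_ge0 => k _; exact: frob_ge0.
Qed.

End ColumnNorm.

Section FrobeniusMul.
Context {R : realType} {m n p : nat}.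

Lemma frob_mul_tr (u : 'M[R]_(m, p)) (C : 'M[R]_(n, p)) (z : 'M[R]_(m, n)) :
  frob (u *m C^T) z = frob u (z *m C).
Proof.
rewrite /frob; apply: eq_bigr => i _.
under eq_bigr do rewrite mxE mulr_suml.
rewrite exchange_big/=; apply: eq_bigr => k _; rewrite mxE mulr_sumr.
by apply: eq_bigr => j _; rewrite mxE; ring.
Qed.

Lemma mulmx_bounded (C : 'M[R]_(n, p)) : exists2 L : R, 0 <= L &
  forall z : 'M[R]_(m, n), enorm (z *m C) <= L * enorm z.
Proof.
exists ((m * p).+1%:R * \sum_l \sum_k `|C l k|).
  by rewrite mulr_ge0// sumr_ge0// => l _; exact: sumr_ge0.
move=> z; rewrite (le_trans (enorm_le_mxnorm _))// -mulrA ler_wpM2l//.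
apply: mxnorm_le => [|i k].
  by rewrite mulr_ge0 ?enorm_ge0// sumr_ge0// => l _; exact: sumr_ge0.
rewrite mxE (le_trans (ler_norm_sum _ _ _))// mulr_suml; apply: ler_sum => l _.
rewrite normrM mulrC ler_pM ?ler_entry_enorm//.
by rewrite (bigD1 k)//= lerDl sumr_ge0.
Qed.

End FrobeniusMul.

(** * Differentiability almost everywhere of Lipschitz functions *)

Section LipschitzDifferentiable.
Context {R : realType}.
Implicit Types F : R -> R.

Let mu := @lebesgue_measure R.

Lemma lipschitz_cumulative F (K : R) :
  (forall s t, s <= t -> F s <= F t) ->
  (forall s t, s <= t -> F t - F s <= K * (t - s)) ->
  exists F' : cumulative R R, F' =1 F.
Proof.
move=> Fnd FK.
have Fc : continuous F.
  apply: (@lipschitz_continuousR _ _ _ `|K|) => s t.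
  have [st|ts] := leP s t.
    by rewrite (@le_trans _ _ 0)// ?subr_le0 ?Fnd// mulr_ge0.
  rewrite (le_trans (FK _ _ (ltW ts)))// (gtr0_norm (_ : 0 < s - t)) ?subr_gt0//.
  by rewrite ler_wpM2r ?ler_norm// subr_ge0 ltW.
have Fr := right_continuousW Fc.
pose F' : cumulative R R := HB.pack F (isCumulative.Build R _ R F Fnd Fr).
by exists F'.
Qed.

Lemma lebesgue_stieltjes_itv (F : cumulative R R) (a b : R) : a <= b ->
  lebesgue_stieltjes_measure F `]a, b]%classic = (F b - F a)%:E.
Proof.
move=> ab; rewrite /lebesgue_stieltjes_measure /measure_extension/=.
by rewrite measurable_mu_extE/= ?wlength_itv_bnd//; exact: is_ocitv.
Qed.

(** Both F and K t - F t are nondecreasing, and their Lebesgue-Stieltjes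
    measures add up to K times the Lebesgue measure. *)
Lemma lebesgue_stieltjes_dominated (F : cumulative R R) (K : R) : 0 < K ->
  (forall s t, s <= t -> F t - F s <= K * (t - s)) ->
  lebesgue_stieltjes_measure F `<< mu.
Proof.
move=> K0 FK.
have [||G GE] := @lipschitz_cumulative (fun t => K * t - F t) K.
- by move=> s t st; have := FK _ _ st; lra.
- move=> s t st; have := @cumulative_is_nondecreasing _ _ _ F _ _ st; lra.
have Ki : 0 <= K^-1 by rewrite invr_ge0 ltW.
pose nu := mscale (NngNum Ki) (measure_add (lebesgue_stieltjes_measure F)
  (lebesgue_stieltjes_measure G)).
have muE : forall A, measurable A -> lebesgue_measure A = nu A.
  apply: lebesgue_measure_unique => X /ocitvP[->|[[a b]/= ab ->]].
    by rewrite !measure0.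
  transitivity ((K^-1)%:E * measure_add (lebesgue_stieltjes_measure F)
    (lebesgue_stieltjes_measure G) `]a, b]%classic)%E; last by [].
  have FE := lebesgue_stieltjes_itv F (ltW ab).
  have GE' := lebesgue_stieltjes_itv G (ltW ab).
  transitivity ((K^-1)%:E * ((F b - F a)%:E + (G b - G a)%:E))%E; last first.
    congr (_ * _)%E; rewrite measure_addE; congr (_ + _)%E; first exact: esym FE.
    exact: esym GE'.
  rewrite lebesgue_measure_itv/= lte_fin ab -EFinD -EFinM !GE.
  by congr EFin; field; rewrite gt_eqF.
apply/null_content_dominatesP => A mA A0.
have : ((K^-1)%:E * measure_add (lebesgue_stieltjes_measure F)
    (lebesgue_stieltjes_measure G) A = 0)%E by rewrite -A0; apply/esym/muE.
move=> /eqP; rewrite mule_eq0 eqe invr_eq0 gt_eqF//= measure_addE.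
rewrite padde_eq0 ?measure_ge0// => /andP[/eqP-> _] //.
Qed.

(** The Lebesgue-Stieltjes measure of F has a density by the Radon-Nikodym
    theorem, so that F is an indefinite integral; Lebesgue's differentiation
    theorem applies. *)
Lemma cdf_derivable_ae F (K : R) : 0 < K ->
  (forall s t, s <= t -> F s <= F t) ->
  (forall s t, s <= t -> F t - F s <= K * (t - s)) ->
  F @ -oo --> (0 : R) -> F @ +oo --> (1 : R) ->
  {ae mu, forall t, derivable F t 1}.
Proof.
move=> K0 Fnd FK F0 F1.
have [G GE] := lipschitz_cumulative Fnd FK.
have GE' : F = G by apply/funext => t; rewrite GE.
rewrite GE' in F0 F1 FK *.
pose G' : cumulativeBounded (0:R) (1:R) :=
  HB.pack (G : R -> R) (isCumulativeBounded.Build R 0 1 G F0 F1)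
   (isCumulative.Build R _ R G (@cumulative_is_nondecreasing _ _ _ G)
      (@cumulative_is_right_continuous _ _ _ G)).
pose P : probability _ _ := lebesgue_stieltjes_measure G'.
have Pmu : charge_of_finite_measure P `<< mu by exact: lebesgue_stieltjes_dominated FK.
pose h := Radon_Nikodym (charge_of_finite_measure P) mu.
have hint : mu.-integrable setT h := Radon_Nikodym_integrable Pmu.
have hfin x : h x \is a fin_num := Radon_Nikodym_fin_num x Pmu.
have hE : EFin \o (fine \o h) = h by apply/funext => x /=; rewrite fineK.
have hint' : mu.-integrable setT (EFin \o (fine \o h)) by rewrite hE.
have := @FTC1Ny R (fine \o h).
case.
- by move=> y; apply: integrableS hint'.
- by apply: open_integrable_locally => //; exact: openT.
move=> N [mN N0 sub]; exists N; split => // t /= Gt; apply: sub => /= -[D _].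
apply: Gt; move: D; suff -> : (fun x : R => \int[lebesgue_measure]_(t in `]-oo, x]) fine (h t)) = G by [].
apply/funext => x; rewrite /Rintegral.
have -> : (\int[lebesgue_measure]_(x0 in `]-oo, x]) ((fine \o h) x0)%:E)%E =
   P `]-oo, x]%classic.
  transitivity (charge_of_finite_measure P `]-oo, x]%classic) => //.
  rewrite (Radon_Nikodym_integral Pmu)//.
  by apply: eq_integral => y _ /=; rewrite fineK.
by have := cdf_lebesgue_stieltjes_id G' x; rewrite /cdf /= preimage_id => ->.
Qed.

(** After adding a linear function, freezing the values outside of [a, b]
    and normalizing, F becomes the distribution function of a probability
    measure. *)
Lemma lipschitz_derivable_ae F (a b K : R) :
  (forall s t, a <= s -> s <= t -> t <= b -> `|F t - F s| <= K * (t - s)) ->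
  {ae mu, forall t, a < t < b -> derivable F t 1}.
Proof.
move=> FK.
have [ab|ba] := ltP a b; last first.
  by apply: aeW => t /andP[at_ tb]; have := lt_trans at_ tb; rewrite ltNge ba.
pose c t := Order.max a (Order.min b t).
have ca t : a <= c t by rewrite /c le_max lexx.
have cb t : c t <= b by rewrite /c ge_max (ltW ab)/= ge_min lexx.
have cnd s t : s <= t -> c s <= c t.
  by move=> st; rewrite /c; apply: le_max2 => //; exact: le_min2.
have cid t : a < t < b -> c t = t.
  by move=> /andP[at_ tb]; rewrite /c (min_r (ltW tb)) (max_r (ltW at_)).
have c1 s t : s <= t -> c t - c s <= t - s.
  by move=> st; rewrite /c /Order.max /Order.min; do 4 case: ifPn; rewrite -?leNgt => *; lra.
have K0 : 0 <= K.
  have := FK a b (lexx _) (ltW ab) (lexx _) => /(le_trans (normr_ge0 _)).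
  by rewrite pmulr_lge0 ?subr_gt0.
pose G t := F (c t) + (K + 1) * c t.
have Gs s t : a <= s -> s <= t -> t <= b -> t - s <= F t - F s + (K + 1) * (t - s).
  by move=> as_ st tb; have := FK _ _ as_ st tb; rewrite ler_norml => /andP[+ _]; lra.
have Gs' s t : a <= s -> s <= t -> t <= b -> F t - F s + (K + 1) * (t - s) <= (2 * K + 1) * (t - s).
  by move=> as_ st tb; have := FK _ _ as_ st tb; rewrite ler_norml => /andP[_]; lra.
have caE t : t <= a -> c t = a.
  by move=> ta; rewrite /c min_r ?max_l//; exact: le_trans ta (ltW ab).
have cbE t : b <= t -> c t = b.
  by move=> tb; rewrite /c min_l ?max_r// ltW.
have G0 : 0 < G b - G a.
  rewrite /G (caE a)// (cbE b)//; have := Gs a b (lexx _) (ltW ab) (lexx _); lra.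
pose H t := (G t - G a) / (G b - G a).
have Hd : {ae mu, forall t, derivable H t 1}.
  apply: (@cdf_derivable_ae _ ((2 * K + 1) / (G b - G a))).
  - by rewrite divr_gt0//; lra.
  - move=> s t st; rewrite /H ler_pM2r ?invr_gt0// lerD2r /G.
    by have := Gs _ _ (ca s) (cnd _ _ st) (cb t); have := cnd _ _ st; lra.
  - move=> s t st; rewrite /H -mulrBl -mulrAC ler_pM2r ?invr_gt0//.
    have := Gs' _ _ (ca s) (cnd _ _ st) (cb t); rewrite /G.
    have : (2 * K + 1) * (c t - c s) <= (2 * K + 1) * (t - s).
      by apply: ler_wpM2l; [lra|exact: c1].
    by lra.
  - apply: cvg_near_cst; near=> t.
    have ta : t <= a by near: t; apply: nbhs_ninfty_le; exact: num_real.
    by rewrite /H /G (caE t)// (caE a)// subrr mul0r.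
  - apply: cvg_near_cst; near=> t.
    have tb : b <= t by near: t; apply: nbhs_pinfty_ge; exact: num_real.
    by rewrite /H [G t]/G (cbE t)// -[b in F b + _ * b](cbE b)// divff// gt_eqF.
have aeF : Filter (almost_everywhere mu) := ae_filter_ringOfSetsType mu.
apply: filterS Hd => t Ht tab.
have E s : a < s < b -> F s = (G b - G a) * H s + G a - (K + 1) * s.
  by move=> sab; rewrite /H mulrCA divff ?gt_eqF// mulr1 subrK /G cid// addrK.
have D1 : derivable (fun s : R => (G b - G a) * H s + G a - (K + 1) * s) t 1.
  have DK : derivable (fun s : R => (K + 1) * s) t 1.
    by apply: derivableM; [exact: derivable_cst|exact: derivable_id].
  apply: derivableB DK; apply: derivableD; last exact: derivable_cst.
  by apply: derivableM Ht; exact: derivable_cst.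
apply: (near_eq_derivable _ D1); near=> s; rewrite E//.
by apply/andP; split; near: s; [apply: lt_nbhsr|apply: lt_nbhsl]; case/andP: tab.
Unshelve. all: by end_near. Qed.

End LipschitzDifferentiable.

(** * Monotonicity of absolutely continuous functions *)

Section AbsolutelyContinuousDecrease.
Context {R : realType}.
Let mu := @lebesgue_measure R.

(** The families of intervals to which absolute continuity is applied.
    Sortedness makes the intervals disjoint, so that their lengths add up to
    at most the measure of U. *)
Fixpoint interval_chain (U : set R) (b s : R) (l : seq (R * R)) : Prop :=
  if l is w :: l' then
    [/\ s <= w.1, w.1 <= w.2, `[w.1, w.2[ `<=` U & interval_chain U b w.2 l']
  else s <= b.

Lemma interval_chainW U b s s' l : s' <= s ->
  interval_chain U b s l -> interval_chain U b s' l.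
Proof.
by case: l => [|w l] s's /=; [exact: le_trans|case=> sw *; split => //; exact: le_trans sw].
Qed.

Lemma interval_chain_all U b s l : interval_chain U b s l ->
  all (fun w => (s <= w.1) && (w.1 <= w.2) && (w.2 <= b)) l /\ s <= b.
Proof.
elim: l s => [|w l IH] s //= [sw ww _ /IH[al wb]].
rewrite sw ww wb (le_trans sw (le_trans ww wb)); split => //.
apply: sub_all al => v /andP[/andP[wv -> ->]]; rewrite !andbT.
exact: le_trans sw (le_trans ww wv).
Qed.

Lemma interval_chain_pairwise U b s l : interval_chain U b s l ->
  pairwise (fun u v => (u.2 <= v.1) || (v.2 <= u.1)) l.
Proof.
elim: l s => [|w l IH] s //= [sw ww _ wl]; rewrite (IH _ wl) andbT.
have [al _] := interval_chain_all wl.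
by apply: sub_all al => v /andP[/andP[-> _] _].
Qed.

Lemma interval_chain_measure U b s l : open U -> interval_chain U b s l ->
  ((\sum_(w <- l) (w.2 - w.1))%:E <= mu (U `&` `[s, b]))%E.
Proof.
move=> oU; have mU : measurable U by exact: open_measurable.
elim: l s => [|w l IH] s /=; first by rewrite big_nil measure_ge0.
move=> [sw ww wU wl]; rewrite big_cons EFinD.
have -> : (w.2 - w.1)%:E = mu `[w.1, w.2[%classic.
  rewrite /mu lebesgue_measure_itv/= lte_fin; case: ltP => // h.
  by rewrite (le_anti (introT andP (conj ww h))) subrr.
apply: (@le_trans _ _ (mu `[w.1, w.2[%classic + mu (U `&` `[w.2, b]))%E).
  by rewrite leeD2l// IH.
rewrite -measureU//=; last 2 first.
- by apply: measurableI => //; exact: measurable_itv.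
- rewrite -subset0 => t [] /=; rewrite !in_itv/= => /andP[_ h] [_ /andP[h']].
  by have := lt_le_trans h h'; rewrite ltxx.
apply: le_measure; rewrite ?inE//.
- apply: measurableU; first exact: measurable_itv.
  by apply: measurableI => //; exact: measurable_itv.
- by apply: measurableI => //; exact: measurable_itv.
have [_ wb] := interval_chain_all wl.
move=> t [/[dup] tw|[Ut]] /=; rewrite !in_itv/= => /andP[h1 h2].
  split; first exact: wU; apply/andP; split; first exact: le_trans sw h1.
  exact: le_trans (ltW h2) wb.
by split => //; rewrite h2 andbT (le_trans sw)// (le_trans ww).
Qed.

(** The increments of an absolutely continuous function over a null set are
    absorbed by an open cover U of small measure. Going down from b, the set
    of points s such that h b - h s is at most eps (b - s) plus increments
    over intervals in U is closed under limits and, thanks to the left Dini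
    derivatives, cannot stop before a. *)
Lemma left_dini_nonincreasing (h : R -> R) (a b : R) : a <= b ->
  (forall eps : R, 0 < eps -> exists2 delta : R, 0 < delta &
    forall s : seq (R * R),
    all (fun u => (a <= u.1) && (u.1 <= u.2) && (u.2 <= b)) s ->
    pairwise (fun u v => (u.2 <= v.1) || (v.2 <= u.1)) s ->
    \sum_(u <- s) (u.2 - u.1) < delta ->
    \sum_(u <- s) (h u.2 - h u.1) < eps) ->
  {ae mu, forall t, a < t <= b -> forall eps : R, 0 < eps ->
    exists2 gamma : R, 0 < gamma &
    forall u, a <= u < t -> t - u < gamma -> h t - h u <= eps * (t - u)} ->
  h b <= h a.
Proof.
move=> ab hac [N [mN N0 subN]].
suff main (eps : R) : 0 < eps -> h b - h a <= eps * (b - a) + eps.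
  rewrite -subr_le0; apply/ler_addgt0Pl => /= e e0; rewrite addr0.
  have b1 : 0 < b - a + 1 by rewrite ltr_wpDl// subr_ge0.
  have := main (e / (b - a + 1)) (divr_gt0 e0 b1); set e' := e / _.
  have -> : e' * (b - a) + e' = e' * (b - a + 1) by ring.
  by rewrite /e' divfK// gt_eqF.
move=> eps0; have [delta d0 hd] := hac _ eps0.
have Nlt : (mu N < +oo)%E by rewrite N0.
have [U [oU NU Ud]] := lebesgue_regularity_outer mN Nlt d0.
have mU : measurable U by exact: open_measurable.
have {}Ud : (mu U < delta%:E)%E.
  have -> : mu U = (mu (U `\` N) + mu (U `&` N))%E by apply: measureDI.
  apply: le_lt_trans Ud.
  rewrite -[leRHS]adde0 leeD2l//.
  by rewrite -N0 le_measure// inE//; exact: measurableI.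
pose P s := forall eta : R, 0 < eta -> exists2 l, interval_chain U b s l &
  h b - h s <= eps * (b - s) + \sum_(w <- l) (h w.2 - h w.1) + eta.
pose S := [set s | a <= s <= b /\ P s].
have Sb : S b.
  split; first by rewrite ab lexx.
  move=> eta eta0; exists [::] => //=; rewrite big_nil !subrr mulr0 !add0r.
  exact: ltW.
have S0 : S !=set0 by exists b.
have Sl : has_lbound S by exists a => s [/andP[]].
have Si : has_inf S by split.
pose c := inf S.
have ac : a <= c by apply: lb_le_inf => // s [/andP[]].
have cb : c <= b by apply: ge_inf.
have Pc : P c.
  move=> eta eta0; have [d' d'0 hd'] := hac _ (divr_gt0 eta0 (ltr0Sn _ 1)).
  have [s Ss sc] := inf_adherent d'0 Si.
  have cs : c <= s by exact: ge_inf.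
  case: Ss => /andP[as_ sb] /(_ _ (divr_gt0 eta0 (ltr0Sn _ 1)))[l sl hl].
  exists l; first exact: interval_chainW sl.
  have := hd' [:: (c, s)]; rewrite /= !big_seq1/= ac cs sb => /(_ isT isT).
  rewrite ltrBlDl => /(_ sc) h1.
  have : eps * (b - s) <= eps * (b - c) by rewrite ler_wpM2l ?lerD2l ?lerN2// ltW.
  by move: hl h1; lra.
have [ca|ca] := leP c a.
  have {}ca : c = a by apply/le_anti; rewrite ca ac.
  rewrite -ca; apply/ler_addgt0Pr => eta eta0.
  have [l cl hl] := Pc _ eta0; apply: (le_trans hl); rewrite lerD2r lerD2l ltW//.
  apply: hd.
  - by rewrite -ca; have [] := interval_chain_all cl.
  - exact: interval_chain_pairwise cl.
  - rewrite -lte_fin; apply: le_lt_trans Ud.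
    apply: (le_trans (interval_chain_measure oU cl)).
    apply: le_measure; rewrite ?inE//.
    by apply: measurableI => //; exact: measurable_itv.
suff [u [au uc Pu]] : exists u, [/\ a <= u, u < c & P u].
  have : c <= u by apply: ge_inf => //; split => //; rewrite au (le_trans (ltW uc)).
  by rewrite leNgt uc.
have [Nc|Nc] := pselect (N c).
  have /nbhs_ballP[r /= r0 rU] : nbhs c U by apply: open_nbhs_nbhs; split => //; exact: NU.
  pose u := Order.max a (c - r / 2).
  have uc : u < c by rewrite /u gt_max ca/= ltrBlDr ltrDl divr_gt0.
  have cu : c - r / 2 <= u by rewrite le_max lexx orbT.
  exists u; split => //; first by rewrite le_max lexx.
  move=> eta eta0; have [l cl hl] := Pc _ eta0; exists ((u, c) :: l).
    split => //=; first exact: ltW.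
    move=> t /=; rewrite in_itv/= => /andP[ut tc]; apply: rU.
    by rewrite -ball_normE/= ger0_norm ?subr_ge0 ?(ltW tc)//; lra.
  rewrite big_cons/=.
  have : eps * (b - c) <= eps * (b - u) by rewrite ler_wpM2l ?lerD2l ?lerN2// ltW.
  by move: hl; lra.
have [|gamma g0 hg] := contra_notP (subN c) Nc _ _ eps0; first by rewrite ca.
pose u := Order.max a (c - gamma / 2).
have uc : u < c by rewrite /u gt_max ca/= ltrBlDr ltrDl divr_gt0.
have cu : c - gamma / 2 <= u by rewrite le_max lexx orbT.
have au : a <= u by rewrite le_max lexx.
exists u; split => // eta eta0; have [l cl hl] := Pc _ eta0; exists l.
  by apply: interval_chainW cl; exact: ltW.
have := hg u; rewrite au uc => /(_ isT) => h1.
have {}h1 : h c - h u <= eps * (c - u) by apply: h1; lra.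
by move: hl h1; lra.
Qed.

Context {m n : nat}.
Implicit Types (x : R -> 'M[R]_(m, n)) (psi : 'M[R]_(m, n) -> R).

(** Bounds for subgradients replace a chain rule: a subgradient A at x t
    bounds psi (x t) - psi (x u) by the pairing of A with x t - x u, which
    for u < t is a bound on the left Dini derivative of psi along x. One
    subgradient with a good bound suffices, even where psi is not
    differentiable. *)
Lemma subgradient_decrease x psi (L c a b : R) : a <= b ->
  absolutely_continuous_on a b x ->
  (forall y z, psi y - psi z <= L * enorm (y - z)) ->
  {ae mu, forall t, a < t <= b -> derivable x t 1 /\
    exists2 A, forall z, psi (x t) + frob A (z - x t) <= psi z &
               frob A ('D_1 x t) <= c} ->
  psi (x b) <= psi (x a) + c * (b - a).
Proof.
move=> ab xac psiL xae.
suff : psi (x b) - c * b <= psi (x a) - c * a by lra.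
apply: (@left_dini_nonincreasing (fun t => psi (x t) - c * t)) => //.
  move=> eps eps0.
  have L1 : 0 < `|L| + 1 by rewrite ltr_wpDl.
  have c1 : 0 < `|c| + 1 by rewrite ltr_wpDl.
  have [d d0 hd] := xac (eps / 2 / (`|L| + 1)) (divr_gt0 (divr_gt0 eps0 (ltr0Sn _ 1)) L1).
  exists (Order.min d (eps / 2 / (`|c| + 1))).
    by rewrite lt_min d0 !divr_gt0.
  move=> s sall spw; rewrite lt_min => /andP[/(hd _ sall spw) sx sc].
  have s1 : \sum_(u <- s) (psi (x u.2) - c * u.2 - (psi (x u.1) - c * u.1)) <=
     (`|L| + 1) * (\sum_(u <- s) enorm (x u.2 - x u.1)) +
     (`|c| + 1) * (\sum_(u <- s) (u.2 - u.1)).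
    rewrite !mulr_sumr -big_split/= [leLHS]big_seq [leRHS]big_seq.
    apply: ler_sum => u us; move/allP : sall => /(_ _ us)/andP[/andP[_ u12] _].
    have := psiL (x u.2) (x u.1); have := enorm_ge0 (x u.2 - x u.1).
    set E := enorm _ => E0 hE.
    have h1 : L * E <= (`|L| + 1) * E.
      by rewrite ler_wpM2r// (le_trans (ler_norm _))// lerDl.
    have h2 : - c * (u.2 - u.1) <= (`|c| + 1) * (u.2 - u.1).
      rewrite ler_wpM2r ?subr_ge0// (le_trans (ler_norm _))// normrN lerDl//.
    by lra.
  apply: (le_lt_trans s1).
  by move: sx sc; rewrite !ltr_pdivlMr// ![_ * (_ + 1)]mulrC; lra.
have aeF : Filter (almost_everywhere mu) := ae_filter_ringOfSetsType mu.
apply: filterS xae => t xt tab eps eps0.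
have [xd [A hA cA]] := xt tab.
have [d d0 hd] : exists2 d : R, 0 < d & forall k, `|k| < d -> k != 0 ->
   frob A (k^-1 *: (x (k + t) - x t)) <= c + eps.
  have D : (fun k => k^-1 *: (x (k *: (1 : R) + t) - x t)) @ 0^' --> 'D_1 x t by [].
  have : (fun k => frob A (k^-1 *: (x (k *: (1 : R) + t) - x t))) @ 0^' --> frob A ('D_1 x t).
    by apply: continuous_cvg D; exact: continuous_frob.
  move=> /cvgrPdist_le/(_ _ eps0)[d /= d0 hd]; exists d => // k kd k0.
  have := hd k; rewrite /= sub0r normrN => /(_ kd k0).
  rewrite ler_norml => /andP[]; rewrite /GRing.scale/= mulr1; lra.
exists d => // u /andP[au ut] tud.
have := hd (u - t); rewrite distrC ger0_norm ?subr_ge0 ?(ltW ut)// => /(_ tud).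
rewrite subr_eq0 lt_eqF// => /(_ isT); rewrite subrK frobZr.
rewrite -[u - t]opprB invrN mulNr -mulrN -frobNr opprB.
rewrite mulrC ler_pdivrMr ?subr_gt0//.
have := hA (x u); rewrite -[x u - x t]opprB frobNr; lra.
Qed.

End AbsolutelyContinuousDecrease.

(** * Null sets and Filippov sets *)

Section LebesgueNull.
Context {R : realType}.
Let mu := @lebesgue_measure R.

(** By Tonelli's theorem the mean over t in [p, p + L] of the total volume
    of the slices is at most the total volume divided by L, hence less than
    T. *)
Lemma light_slice (c a b : nat -> R) (p L T : R) : 0 < L -> 0 <= T ->
  (forall k, 0 <= c k) -> (forall k, a k <= b k) ->
  (\sum_(0 <= k <oo) (c k * (b k - a k))%:E < (T * L)%:E)%E ->
  exists2 t, p <= t <= p + L &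
    (\sum_(0 <= k <oo) (c k * \1_(`[a k, b k]%classic) t)%:E < T%:E)%E.
Proof.
move=> L0 T0 c0 ab cT; apply: contrapT => H.
have {}H t : p <= t <= p + L ->
    (T%:E <= \sum_(0 <= k <oo) (c k * \1_(`[a k, b k]%classic) t)%:E)%E.
  by move=> tp; rewrite leNgt; apply/negP => h; apply: H; exists t.
pose D : set R := `[p, p + L]%classic.
have mD : measurable D by exact: measurable_itv.
pose f k t := ((c k)%:E * (\1_(`[a k, b k]%classic) t)%:E)%E.
have f0 k t : (0 <= f k t)%E by rewrite mule_ge0// lee_fin.
have mi k : measurable_fun D (EFin \o (\1_(`[a k, b k]%classic) : R -> R)).
  by apply/measurable_EFinP; apply: measurable_indic; exact: measurable_itv.
have mf k : measurable_fun D (f k).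
  by apply: measurable_funeM; exact: mi.
suff : ((T * L)%:E <= \sum_(0 <= k <oo) (c k * (b k - a k))%:E)%E by rewrite leNgt cT.
have -> : ((T * L)%:E = \int[mu]_(t in D) cst T%:E t)%E.
  have muD : mu D = L%:E.
    rewrite /mu /D lebesgue_measure_itv/= lte_fin ltrDl L0 -EFinD.
    by rewrite addrAC subrr add0r.
  transitivity (T%:E * mu D)%E; last by apply: esym; exact: integral_cst.
  by rewrite EFinM; congr (_ * _)%E; exact: esym muD.
apply: (@le_trans _ _ (\int[mu]_(t in D) \sum_(0 <= k <oo) f k t)%E).
  apply: ge0_le_integral => //.
  apply: (@ge0_emeasurable_sum _ _ _ D f xpredT); first by move=> k t Dt _; exact: f0.
  by move=> k _; exact: mf.
rewrite integral_nneseries//; apply: lee_nneseries => k _.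
  by move=> _; apply: integral_ge0 => t _; exact: f0.
rewrite /f ge0_integralZl_EFin//; last exact: mi.
rewrite integral_indic//.
rewrite EFinM lee_wpmul2l ?lee_fin//.
apply: (@le_trans _ _ (mu `[a k, b k]%classic)).
  apply: le_measure; rewrite ?inE//; try exact: measurable_itv.
  by apply: measurableI => //; exact: measurable_itv.
rewrite /mu lebesgue_measure_itv/= lte_fin; case: ltP => // h.
by rewrite lee_fin subr_ge0.
Qed.

(** A point of the cube that lies in no box is built one coordinate at a
    time, each time choosing a slice of small total volume; the weights c
    record which boxes contain the coordinates chosen so far. When no
    coordinate is left the total is the number of boxes around the point,
    and it is less than 1. *)
Lemma avoid_boxes (I : eqType) (l : seq I) (a b : nat -> I -> R) (c : nat -> R)
    (p : I -> R) (L : R) : 0 < L -> uniq l ->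
  (forall k, 0 <= c k) -> (forall k i, a k i <= b k i) ->
  (\sum_(0 <= k <oo) (c k * \prod_(i <- l) (b k i - a k i))%:E
     < (L ^+ size l)%:E)%E ->
  exists2 y : I -> R, forall i, i \in l -> p i <= y i <= p i + L &
    (\sum_(0 <= k <oo) (c k * \prod_(i <- l) \1_(`[a k i, b k i]%classic) (y i))%:E
      < 1)%E.
Proof.
move=> L0; elim: l c => [|i l IH] c /=.
  move=> _ c0 ab; under eq_eseriesr do rewrite big_nil; move=> h.
  by exists p => //; under eq_eseriesr do rewrite big_nil.
move=> /andP[il ul] c0 ab; under eq_eseriesr do rewrite big_cons mulrCA mulrC; move=> h.
have cl k : 0 <= c k * \prod_(j <- l) (b k j - a k j).
  by rewrite mulr_ge0// prodr_ge0// => j _; rewrite subr_ge0.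
have Ls : 0 <= L ^+ size l by rewrite exprn_ge0// ltW.
have hh : (\sum_(0 <= k <oo) ((c k * \prod_(j <- l) (b k j - a k j)) * (b k i - a k i))%:E
   < (L ^+ size l * L)%:E)%E by rewrite -exprSr.
have [t tp ht] := @light_slice _ _ _ (p i) _ _ L0 Ls cl (fun k => ab k i) hh.
pose c' k := c k * \1_(`[a k i, b k i]%classic) t.
have [||y yp hy] := IH c' ul _ ab.
- by move=> k; rewrite mulr_ge0.
- by apply: le_lt_trans ht; under eq_eseriesr do rewrite mulrAC.
exists (fun j => if j == i then t else y j).
  by move=> j; rewrite inE; case: eqVneq => [->|] //= _; exact: yp.
apply: le_lt_trans hy; under eq_eseriesr do rewrite big_cons eqxx mulrA -/(c' _).
apply: lee_nneseries => k _.
  move=> _; rewrite lee_fin mulr_ge0 ?mulr_ge0// prodr_ge0// => j _.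
rewrite lee_fin le_eqVlt; apply/orP; left; apply/eqP; congr (_ * _).
rewrite big_seq [RHS]big_seq; apply: eq_bigr => j jl.
by case: eqVneq => // ji; move: il; rewrite -ji jl.
Qed.

Context {m n : nat}.

Lemma lebesgue_null_avoid (S : set 'M[R]_(m, n)) (x : 'M[R]_(m, n)) (d : R) :
  0 < d -> lebesgue_null S -> exists2 y, `|y - x| < d & ~ S y.
Proof.
move=> d0 nS; have d2 : 0 < d / 2 by rewrite divr_gt0.
pose I : finType := ('I_m * 'I_n)%type; pose l := enum I.
have [|a [b [ab Sab vol]]] := nS ((d / 2) ^+ size l / 2).
  by rewrite divr_gt0// exprn_gt0.
have prodE (F : I -> R) : \prod_(ij <- l) F ij = \prod_i \prod_j F (i, j).
  by rewrite pair_bigA /l big_enum/=; apply: eq_bigr => -[].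
have [] := @avoid_boxes I l (fun k ij => a k ij.1 ij.2) (fun k ij => b k ij.1 ij.2)
   (fun=> 1) (fun ij => x ij.1 ij.2) _ d2 (enum_uniq _) (fun=> ler01) (fun k ij => ab k ij.1 ij.2).
  under eq_eseriesr do rewrite mul1r prodE/=.
  apply: (le_lt_trans vol); rewrite lte_fin ltr_pdivrMr// mulr_natr mulr2n ltrDl.
  exact: exprn_gt0.
move=> y yp hy; exists (\matrix_(i, j) y (i, j)).
  apply: mxnorm_lt => // i j; rewrite !mxE.
  have := yp (i, j); rewrite mem_enum => /(_ isT)/= /andP[h1 h2].
  rewrite ger0_norm ?subr_ge0//; lra.
move=> /Sab[k _ /= yk].
move: hy; rewrite ltNge => /negP; apply.
pose F (k' : nat) : R := 1 * \prod_(ij <- l)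
  \1_(`[a k' ij.1 ij.2, b k' ij.1 ij.2]%classic) (y ij).
have F0 (k' : nat) : 0 <= F k' by rewrite /F mul1r prodr_ge0.
have Fk : F k = 1.
  rewrite /F mul1r big1// => -[i j] _; rewrite indicE mem_set//=.
  by have := yk i j; rewrite mxE in_itv.
apply: (@le_trans _ _ (\sum_(0 <= k' < k.+1) (F k')%:E)%E); last first.
  by apply: (@nneseries_lim_ge R (EFin \o F) xpredT 0 k.+1) => k' _ _; rewrite lee_fin.
by rewrite big_nat_recr//= Fk leeDr// sume_ge0// => k' _; rewrite lee_fin.
Qed.

Lemma lebesgue_null0 : (0 < m)%N -> (0 < n)%N -> lebesgue_null (@set0 'M[R]_(m, n)).
Proof.
move=> m0 n0 eps eps0; exists (fun=> 0), (fun=> 0); split => //.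
apply: (@le_trans _ _ 0%E); last by rewrite lee_fin ltW.
rewrite le_eqVlt; apply/orP; left; apply/eqP; apply: eseries0 => k _ _.
under eq_bigr do under eq_bigr do rewrite subrr.
by rewrite (bigD1 (Ordinal m0))//= (bigD1 (Ordinal n0))//= !mul0r.
Qed.

End LebesgueNull.

Section FilippovSet.
Context {R : realType} {m n : nat}.
Implicit Types (g : 'M[R]_(m, n) -> 'M[R]_(m, n)) (x A : 'M[R]_(m, n)).

Lemma convmxE (k : {i01 R}) (u v : 'M[R]_(m, n)) :
  conv k (u : convex_lmodType 'M[R]_(m, n)) v = k%:num *: u + (1 - k%:num) *: v.
Proof. by []. Qed.

Lemma halfspace_closed A (c : R) : closed [set v | frob A v <= c].
Proof.
rewrite (_ : mkset _ = frob A @^-1` [set r | r <= c])//.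
by apply: closed_comp; [move=> v _; exact: continuous_frob|exact: closed_le].
Qed.

Lemma halfspace_convex A (c : R) : @convex_set R 'M[R]_(m, n) [set v | frob A v <= c].
Proof.
move=> u v k; rewrite !inE/= => uc vc.
rewrite convmxE frobDr !frobZr.
have k1 : 0 <= 1 - k%:num by rewrite subr_ge0 le1.
have -> : c = k%:num * c + (1 - k%:num) * c by ring.
by rewrite lerD// ler_wpM2l.
Qed.

(** A linear bound on the values of g near x passes to the Filippov set,
    because half-spaces are closed and convex. *)
Lemma filippov_le g x A (c : R) : (0 < m)%N -> (0 < n)%N ->
  (forall eps : R, 0 < eps -> \forall y \near nbhs x, frob A (g y) <= c + eps) ->
  forall w, filippov g x w -> frob A w <= c.
Proof.
move=> m0 n0 gA w gw; apply/ler_addgt0Pr => eps eps0.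
have [d d0 dA] := nbhs_eball (gA _ eps0).
apply: (gw d d0 set0 (lebesgue_null0 m0 n0) [set v | frob A v <= c + eps]).
split; first by split; [exact: halfspace_closed|exact: halfspace_convex].
by move=> _ [y [/dA ? _] <-].
Qed.

(** The complement of a null set is dense, so the value of g at a point of
    continuity is a limit of values of g off the null set. *)
Lemma closed_values (B : set 'M[R]_(m, n)) (U S : set 'M[R]_(m, n)) g x :
  closed B -> lebesgue_null S -> nbhs x U -> {for x, continuous g} ->
  g @` (U `\` S) `<=` B -> B (g x).
Proof.
move=> Bc nS Ux gx gB; apply: Bc => V Vg.
have /nbhs_ballP[d /= d0 dUV] : nbhs x (U `&` g @^-1` V).
  by apply: filterI => //; exact: gx.
have [y yx Sy] := lebesgue_null_avoid x d0 nS.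
have [Uy Vy] : (U `&` g @^-1` V) y by apply: dUV; rewrite -ball_normE/= distrC.
by exists (g y); split => //; apply: gB; exists y.
Qed.

Lemma convex_average (B : set 'M[R]_(m, n)) (v : nat -> 'M[R]_(m, n)) (N : nat) :
  @convex_set R 'M[R]_(m, n) B -> (forall j, (j <= N)%N -> B (v j)) ->
  B (N.+1%:R^-1 *: \sum_(j < N.+1) v j).
Proof.
move=> cB; elim: N => [|N IH] Bv.
  by rewrite invr1 scale1r big_ord1; exact: Bv.
have N1 : (0 : R) < N.+1%:R by rewrite ltr0n.
have N2 : (0 : R) < N.+2%:R by rewrite ltr0n.
have k0 : 0 <= N.+1%:R / N.+2%:R :> R by rewrite divr_ge0.
have k1 : N.+1%:R / N.+2%:R <= 1 :> R by rewrite ler_pdivrMr// mul1r ler_nat.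
have := cB (N.+1%:R^-1 *: \sum_(j < N.+1) v j) (v N.+1) (Itv01 k0 k1).
rewrite !inE => /(_ _ _)/wrap[].
  by apply: IH => j jN; apply: Bv; exact: leqW.
  exact: Bv.
rewrite convmxE /=; suff -> : N.+2%:R^-1 *: \sum_(j < N.+2) v j =
  (N.+1%:R / N.+2%:R) *: (N.+1%:R^-1 *: \sum_(j < N.+1) v j) +
  (1 - N.+1%:R / N.+2%:R) *: v N.+1 by [].
rewrite big_ord_recr/= scalerDr scalerA; congr (_ *: _ + _ *: _).
  by rewrite mulrAC divff ?gt_eqF// mul1r.
apply: (mulIf (lt0r_neq0 N2)).
by rewrite mulVf ?gt_eqF// mulrBl divfK ?gt_eqF// mul1r -natrB// subSnn.
Qed.

End FilippovSet.

(** * Local existence of Filippov solutions *)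

Section UltrafilterLimit.
Context {R : realType}.

(** Convergence along an ultrafilter replaces the extraction of
    subsequences. *)
Lemma ultra_bounded_cvg (T : Type) (U : set_system T) (u : T -> R) (B : R) :
  UltraFilter U -> (forall k, `|u k| <= B) -> exists l : R, u @ U --> l.
Proof.
move=> UU uB; have PU : ProperFilter U by exact: ultra_proper.
have cB := @segment_compact R (- B) B.
have [|l [_ ul]] := cB (u @ U) _.
  by apply: (@filterE _ U) => k; rewrite /= in_itv/= -ler_norml; exact: uB.
exists l => V Vl; rewrite /nbhs/=.
have [//|h] := in_ultra_setVsetC (u @^-1` V) UU.
have [x [nVx Vx]] : (~` V) `&` V !=set0 by apply: ul.
by case: (nVx Vx).
Qed.

Context {m n : nat}.

Lemma ultra_bounded_mx (T : Type) (U : set_system T) (X : T -> 'M[R]_(m, n)) (B : R) :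
  UltraFilter U -> (forall k, `|X k| <= B) -> exists l : 'M[R]_(m, n), X @ U --> l.
Proof.
move=> UU XB; have PU : ProperFilter U by exact: ultra_proper.
have h i j : exists l : R, (fun k => X k i j) @ U --> l.
  apply: (@ultra_bounded_cvg _ _ _ B) => k.
  exact: le_trans (normr_entry_le _ _ _) (XB k).
exists (\matrix_(i, j) sval (cid (h i j))); apply: cvg_mx => i j.
by rewrite mxE; exact: (svalP (cid (h i j))).
Qed.

End UltrafilterLimit.

Section FilippovExistence.
Context {R : realType} {m n : nat}.
Variables (g : 'M[R]_(m, n) -> 'M[R]_(m, n)) (z : 'M[R]_(m, n)) (r G : R).
Hypothesis G_ge0 : 0 <= G.
Hypothesis g_bounded : forall x, `|x - z| <= r -> `|g x| <= G.
Hypothesis g_regular : forall x (e : R), `|x - z| <= r -> 0 < e ->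
  exists x', `|x' - x| < e /\ {for x', continuous g}.

Let step (k : nat) : R := k.+1%:R^-1.

Let step_gt0 k : 0 < step k. Proof. by rewrite invr_gt0. Qed.

Let near_point k x := xget x [set x' | `|x' - x| < step k /\ {for x', continuous g}].

Let near_pointP k x : `|x - z| <= r ->
  `|near_point k x - x| < step k /\ {for near_point k x, continuous g}.
Proof. by move=> /g_regular/(_ (step_gt0 k)) h; exact: (xgetPex _ h). Qed.

(* the slopes vanish far from z, which makes all approximations bounded *)
Let slope k x := if `|near_point k x - z| <= r then g (near_point k x) else 0.

Let slope_le k x : `|slope k x| <= G.
Proof. by rewrite /slope; case: ifPn => [/g_bounded//|_]; rewrite normr0. Qed.

Fixpoint euler_node (k j : nat) : 'M[R]_(m, n) :=
  if j is j'.+1 then euler_node k j' + step k *: slope k (euler_node k j')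
  else z.

Let euler_sum k j l :
  euler_node k (j + l) - euler_node k j =
  step k *: \sum_(i < l) slope k (euler_node k (j + i)).
Proof.
elim: l => [|l IH]; first by rewrite addn0 subrr big_ord0 scaler0.
by rewrite addnS /= big_ord_recr/= scalerDr -IH addrAC.
Qed.

Let euler_lip k j l : `|euler_node k (j + l) - euler_node k j| <= l%:R * step k * G.
Proof.
rewrite euler_sum normrZ gtr0_norm// -mulrA mulrCA ler_wpM2l ?(ltW (step_gt0 k))//.
rewrite (le_trans (ler_norm_sum _ _ _))//.
rewrite (le_trans (ler_sum _ (fun i _ => slope_le k _)))//.
by rewrite sumr_const card_ord mulr_natl.
Qed.

Let index k (t : R) := Num.truncn (t / step k).

Let indexP k t : 0 <= t -> (index k t)%:R * step k <= t < (index k t).+1%:R * step k.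
Proof.
move=> t0; have := @truncn_itv R (t / step k).
rewrite divr_ge0 ?(ltW (step_gt0 k))// => /(_ isT).
by rewrite ler_pdivlMr// ltr_pdivrMr.
Qed.

Let index_le k s t : s <= t -> (index k s <= index k t)%N.
Proof. by move=> st; rewrite le_truncn// ler_pM2r// invr_gt0. Qed.

Let euler k t := euler_node k (index k t).

Let index_sub k s t : 0 <= s -> s <= t ->
  t - s - step k <= (index k t - index k s)%:R * step k <= t - s + step k.
Proof.
move=> s0 st; have /andP[s1 s2] := indexP k s0.
have /andP[t1 t2] := indexP k (le_trans s0 st).
rewrite natrB ?index_le// mulrBl; move: s2 t2; rewrite -!natr1 !mulrDl !mul1r.
by lra.
Qed.

Let euler_lipschitz k s t : 0 <= s -> s <= t ->
  `|euler k t - euler k s| <= (t - s + step k) * G.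
Proof.
move=> s0 st; have := euler_lip k (index k s) (index k t - index k s).
rewrite subnKC ?index_le// => /le_trans; apply; rewrite ler_wpM2r//.
by have /andP[] := index_sub k s0 st.
Qed.

Let step_cvg : step @ \oo --> (0 : R). Proof. exact: cvg_harmonic. Qed.

(** The limit along an ultrafilter of Euler step functions whose slopes are
    values of g at nearby points of continuity. A difference quotient of the
    limit is a limit of averages of such values; by density of the
    complements of null sets, all of these lie in every closed convex set
    that occurs in the definition of the Filippov set. *)
Lemma filippov_local_existence : exists y : R -> 'M[R]_(m, n),
  [/\ y 0 = z,
      forall s t, 0 <= s -> s <= t -> `|y t - y s| <= G * (t - s) &
      forall t, 0 < t -> G * t < r -> derivable y t 1 -> filippov g (y t) ('D_1 y t)].
Proof.
have [U [UU Usub]] := @ultraFilterLemma nat \oo _.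
have PU : ProperFilter U by exact: ultra_proper.
have stepU : step @ U --> (0 : R).
  by move=> V /step_cvg /Usub.
have stepU_lt e : 0 < e -> \forall k \near U, step k < e.
  move=> e0; move/cvgrPdist_lt : stepU => /(_ _ e0); apply: filterS => k.
  by rewrite sub0r normrN gtr0_norm.
have step1 k : step k <= 1 by rewrite invf_le1// ler1n.
have lim t : exists l : 'M[R]_(m, n), (fun k => euler k (Order.max 0 t)) @ U --> l.
  apply: (@ultra_bounded_mx _ _ _ _ _ _ (`|z| + (Order.max 0 t + 1) * G)) => // k.
  have t0 : 0 <= Order.max 0 t by rewrite le_max lexx.
  have := euler_lipschitz k (lexx 0) t0.
  rewrite {2}/euler (_ : index k 0 = 0%N)/=; last by rewrite /index mul0r truncn0.
  rewrite subr0 => h; rewrite -(subrK z (euler _ _)) addrC (le_trans (ler_normD _ _))//.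
  rewrite lerD2l (le_trans h)// ler_wpM2r// lerD2l//.
pose y t := sval (cid (lim t)).
have yP t : 0 <= t -> euler^~ t @ U --> y t.
  by move=> t0; rewrite /y; case: cid => l /=; rewrite max_r.
have y0 : y 0 = z.
  have := yP 0 (lexx 0); rewrite (_ : euler^~ 0 = cst z).
    by move=> h; apply: (cvg_unique _ h (cvg_cst z)); exact: norm_hausdorff.
  by apply/funext => k; rewrite /euler /index mul0r truncn0.
have yL s t : 0 <= s -> s <= t -> `|y t - y s| <= G * (t - s).
  move=> s0 st.
  have c1 : (fun k => `|euler k t - euler k s|) @ U --> `|y t - y s|.
    by apply: cvg_norm; apply: cvgB; apply: yP => //; exact: le_trans st.
  have c2 : (fun k => (t - s + step k) * G) @ U --> (t - s + 0) * G.
    by apply: cvgMl; apply: cvgD => //; exact: cvg_cst.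
  rewrite mulrC -[t - s]addr0; apply: (ler_cvg_to c1 c2).
  by apply: filterE => k; exact: euler_lipschitz.
exists y; split => // t t0 tr yd d d0 S nS B [[Bc Bv] gB].
have ytz : `|y t - z| < r.
  by apply: le_lt_trans tr; rewrite -y0 -[t in X in _ <= X]subr0 yL// ltW.
(* the slopes of the approximations near y t will lie in B *)
have [e e0 eB] : exists2 e : R, 0 < e & forall x, `|x - y t| < e ->
    `|x - z| <= r /\ ({for x, continuous g} -> B (g x)).
  have /nbhs_ballP[e1 /= e10 he1] := enorm_ball_nbhs (y t) d0.
  exists (Order.min e1 (r - `|y t - z|)); first by rewrite lt_min e10 subr_gt0.
  move=> x; rewrite lt_min => /andP[xe1 xr]; split.
    by rewrite -(subrKA (y t)) (le_trans (ler_normD _ _))//; lra.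
  move=> gx; apply: (@closed_values _ _ _ B (eball (y t) d) S) => //.
  have : nbhs x (ball (y t) e1).
    apply: open_nbhs_nbhs; split; first exact: ball_open.
    by rewrite -ball_normE/= distrC.
  by apply: filterS.
have [eta eta0 heta] : exists2 eta : R, 0 < eta & eta * G < e / 4.
  exists (e / 4 / (G + 1)); first by rewrite !divr_gt0// ltr_wpDl.
  by rewrite mulrAC ltr_pdivrMr ?ltr_wpDl// ltr_pM2l ?divr_gt0// ltrDl.
(* the increment of an approximation over [t, t + s] is s, up to one step, times
   the mean of its N k slopes *)
have quot s : 0 < s -> s < eta -> B (s^-1 *: (y (s + t) - y t)).
  move=> s0 se; have st : t <= s + t by rewrite lerDr ltW.
  pose N k := (index k (s + t) - index k t)%N.
  have Ncvg : (fun k => (N k)%:R * step k) @ U --> s.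
    apply: (@squeeze_cvgr _ _ _ _ (fun k => s - step k) (fun k => s + step k)).
    - apply: filterE => k.
      by have := index_sub k (ltW t0) st; rewrite (_ : s + t - t = s)//; ring.
    - by rewrite -[X in _ --> X]subr0; apply: cvgB => //; exact: cvg_cst.
    - by rewrite -[X in _ --> X]addr0; apply: cvgD => //; exact: cvg_cst.
  have Qcvg : (fun k => ((N k)%:R * step k)^-1 *: (euler k (s + t) - euler k t)) @ U -->
      s^-1 *: (y (s + t) - y t).
    apply: cvgZ; first by apply: cvgV => //; rewrite gt_eqF.
    by apply: cvgB; apply: yP; [exact: le_trans (ltW t0) st|exact: ltW].
  apply: (@closed_cvg _ _ _ PU _ B Bc _ _ Qcvg).
  have near1 : \forall k \near U, `|euler k t - y t| < e / 4.
    have := yP t (ltW t0) => /cvgrPdist_lt/(_ (e / 4)).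
    by rewrite divr_gt0// => /(_ isT); apply: filterS => k; rewrite distrC.
  have near2 : \forall k \near U, step k < e / 4 by apply: stepU_lt; rewrite divr_gt0.
  have near3 : \forall k \near U, step k * G < e / 4.
    have e4 : 0 < e / 4 / (G + 1) by rewrite !divr_gt0// ltr_wpDl.
    apply: filterS (stepU_lt _ e4) => k; rewrite ltr_pdivlMr ?ltr_wpDl//.
    by apply: le_lt_trans; rewrite ler_wpM2l ?(ltW (step_gt0 k))// lerDl.
  have near4 : \forall k \near U, step k < s by apply: stepU_lt.
  near=> k.
  have k1 : `|euler k t - y t| < e / 4 by near: k.
  have k2 : step k < e / 4 by near: k.
  have k3 : step k * G < e / 4 by near: k.
  have k4 : step k < s by near: k.
  have /andP[N1 N2] := index_sub k (ltW t0) st.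
  have N0 : (0 < N k)%N.
    rewrite lt0n; apply/eqP => Nk0; move: N1; rewrite -/(N k) Nk0 mul0r; lra.
  have -> : euler k (s + t) - euler k t =
      step k *: \sum_(i < N k) slope k (euler_node k (index k t + i)).
    by rewrite -euler_sum subnKC// index_le.
  rewrite scalerA invfM -mulrA mulVf ?gt_eqF// mulr1.
  rewrite -(prednK N0); apply: (@convex_average _ _ _ B
    (fun i => slope k (euler_node k (index k t + i)))) => // i iN.
  set p := euler_node k _.
  have pt : `|p - euler k t| < e / 2.
    apply: (le_lt_trans (euler_lip _ _ _)).
    have iN' : (i <= N k)%N by rewrite (leq_trans iN)// leq_pred.
    apply: (@le_lt_trans _ _ ((s + step k) * G)).
      apply: ler_wpM2r => //; apply: (@le_trans _ _ ((N k)%:R * step k)).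
        by rewrite ler_wpM2r ?(ltW (step_gt0 k))// ler_nat.
      by apply: le_trans N2 _; rewrite addrK.
    have : s * G <= eta * G by rewrite ler_wpM2r// ltW.
    by lra.
  have py : `|p - y t| < e.
    have : `|p - y t| <= `|p - euler k t| + `|euler k t - y t|.
      by rewrite -(subrKA (euler k t)) ler_normD.
    by lra.
  have [qp qc] := near_pointP k (eB _ py).1.
  have qy : `|near_point k p - y t| < e.
    rewrite -(subrKA p) (le_lt_trans (ler_normD _ _))//.
    have : `|p - y t| <= `|p - euler k t| + `|euler k t - y t|.
      by rewrite -(subrKA (euler k t)) ler_normD.
    by lra.
  have [qr qB] := eB _ qy.
  by rewrite /slope qr; exact: qB.
have D : (fun k => k^-1 *: (y (k *: (1 : R) + t) - y t)) @ (0 : R)^'+ --> 'D_1 y t.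
  move=> V /yd; rewrite /nbhs/= /at_right /dnbhs /within/=.
  by apply: filterS => k h k0; apply: h => //; rewrite gt_eqF.
apply: (@closed_cvg _ _ _ _ _ B Bc _ _ D).
near=> k; rewrite /GRing.scale/= mulr1; apply: quot.
  by near: k; exact: nbhs_right_gt.
by near: k; exact: nbhs_right_lt.
Unshelve. all: by end_near. Qed.

End FilippovExistence.

(** * Extension of Filippov solutions *)

Section SolutionExtension.
Context {R : realType} {m n : nat}.
Implicit Types (x : R -> 'M[R]_(m, n)) (J : set R) (D : set 'M[R]_(m, n)).
Variable g : 'M[R]_(m, n) -> 'M[R]_(m, n).
Let mu := @lebesgue_measure R.

Lemma solution_decrease D J x psi (L c : R) : filippov_solution D g J x ->
  (forall y z, psi y - psi z <= L * enorm (y - z)) ->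
  (forall t, J t -> 0 < t -> exists2 A, forall z, psi (x t) + frob A (z - x t) <= psi z &
     forall w, filippov g (x t) w -> frob A w <= c) ->
  forall a b, J a -> J b -> a <= b -> psi (x b) <= psi (x a) + c * (b - a).
Proof.
move=> [[Jitv J0 Jge _] _ xac xae] psiL hA a b Ja Jb ab.
have a0 : 0 <= a by exact: Jge.
apply: (@subgradient_decrease R m n x psi L c a b ab _ psiL).
  move=> eps eps0; have [d d0 hd] := xac b Jb eps eps0; exists d => // s sall.
  apply: hd; apply: sub_all sall => u /andP[/andP[au -> ->]].
  by rewrite (le_trans a0 au).
have aeF : Filter (almost_everywhere mu) := ae_filter_ringOfSetsType mu.
apply: filterS xae => t xt /andP[at_ tb].
have Jt : J t by apply: (Jitv a b) => //; rewrite (ltW at_) tb.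
have [xd xF] := xt Jt; split => //.
have [A hA1 hA2] := hA _ Jt (le_lt_trans a0 at_).
by exists A => //; exact: hA2.
Qed.

Lemma frob_delta_mx i j (z : 'M[R]_(m, n)) : frob (delta_mx i j) z = z i j.
Proof.
rewrite /frob (bigD1 i)//= (bigD1 j)//= !mxE !eqxx mul1r !big1 ?addr0//.
- move=> k ki; apply: big1 => l _; rewrite mxE (negbTE ki) mul0r//.
- by move=> l lj; rewrite mxE (negbTE lj) andbF mul0r.
Qed.

(** The coordinates and their opposites are linear, so each is its own
    subgradient. *)
Lemma solution_lipschitz D J x (G : R) : (0 < m)%N -> (0 < n)%N ->
  filippov_solution D g J x ->
  (forall t, J t -> \forall y \near nbhs (x t), `|g y| <= G) ->
  forall s t, J s -> J t -> s <= t -> `|x t - x s| <= G * (t - s).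
Proof.
move=> m0 n0 xsol gG s t Js Jt st.
have G0 : 0 <= G.
  have [_ _ _ _] := xsol; have [y] := filter_ex (gG _ Js).
  exact: le_trans (normr_ge0 _).
have ent i j (b : bool) : (-1) ^+ b * x t i j <= (-1) ^+ b * x s i j + G * (t - s).
  apply: (@solution_decrease D J x (fun z => (-1) ^+ b * z i j) 1 G xsol) => //.
    move=> y z; rewrite mul1r -mulrBr.
    apply: le_trans (ler_norm _) _; rewrite normrM normrX normrN1 expr1n mul1r.
    by have := ler_entry_enorm (y - z) i j; rewrite !mxE.
  move=> u Ju u0; exists ((-1) ^+ b *: delta_mx i j).
    by move=> z; rewrite frobZl frob_delta_mx !mxE mulrBr addrC subrK.
  apply: filippov_le => // eps eps0; apply: filterS (gG _ Ju) => y gy.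
  rewrite frobZl frob_delta_mx.
  apply: le_trans (ler_norm _) _; rewrite normrM normrX normrN1 expr1n mul1r.
  rewrite (le_trans (normr_entry_le _ _ _))// (le_trans gy)// lerDl ltW//.
apply: mxnorm_le => [|i j]; first by rewrite mulr_ge0// subr_ge0.
rewrite !mxE ler_norml.
have := ent i j false; have := ent i j true; rewrite expr0 expr1 !mul1r !mulN1r; lra.
Qed.

(** The lower bounds h s - M (a - s) for the value at a never exceed the
    upper bounds h t + M (a - t), so their supremum lies between them. *)
Lemma lipschitz_end_value J (h : R -> R) (M a : R) : J !=set0 -> (forall t, J t -> t <= a) ->
  (forall s t, J s -> J t -> s <= t -> `|h t - h s| <= M * (t - s)) -> 0 <= M ->
  exists l, forall t, J t -> `|l - h t| <= M * (a - t).
Proof.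
move=> [t0 Jt0] Ja hM M0.
pose S := [set h s - M * (a - s) | s in J].
have ub t : J t -> forall s, J s -> h s - M * (a - s) <= h t + M * (a - t).
  move=> Jt s Js; have := Ja _ Jt; have := Ja _ Js => sa ta.
  have h1 := mulr_ge0 M0 (_ : 0 <= a - s); have h2 := mulr_ge0 M0 (_ : 0 <= a - t).
  have [st|ts] := leP s t.
    have := hM _ _ Js Jt st; rewrite ler_norml; move: h1 h2; rewrite !subr_ge0 => /(_ sa) + /(_ ta).
    by lra.
  have := hM _ _ Jt Js (ltW ts); rewrite ler_norml; move: h1 h2; rewrite !subr_ge0 => /(_ sa) + /(_ ta).
  by lra.
have S0 : S !=set0 by exists (h t0 - M * (a - t0)), t0.
exists (sup S) => t Jt; rewrite ler_norml.
have h1 : h t - M * (a - t) <= sup S.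
  apply: ub_le_sup; last by exists t.
  by exists (h t + M * (a - t)) => _ [s Js <-]; exact: ub.
have h2 : sup S <= h t + M * (a - t) by apply: ge_sup => // _ [s Js <-]; exact: ub.
by apply/andP; split; lra.
Qed.

Lemma lipschitz_absolutely_continuous x (K a b : R) : 0 <= K ->
  (forall s t, a <= s -> s <= t -> t <= b -> `|x t - x s| <= K * (t - s)) ->
  absolutely_continuous_on a b x.
Proof.
move=> K0 xK eps eps0.
have C0 : 0 < (m * n).+1%:R * K + 1 by rewrite ltr_wpDl// mulr_ge0.
exists (eps / ((m * n).+1%:R * K + 1)); first by rewrite divr_gt0.
move=> s sall _; rewrite ltr_pdivlMr// mulrC; apply: le_lt_trans.
rewrite mulr_sumr [leLHS]big_seq [leRHS]big_seq; apply: ler_sum => u us.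
move/allP : sall => /(_ _ us)/andP[/andP[au uu] ub].
rewrite (le_trans (enorm_le_mxnorm _))//.
apply: (@le_trans _ _ ((m * n).+1%:R * (K * (u.2 - u.1)))).
  by rewrite ler_wpM2l// xK.
by rewrite mulrA ler_wpM2r ?subr_ge0// lerDl.
Qed.

Lemma ae_neq (c : R) : {ae mu, forall t, t != c}.
Proof.
exists [set c]; split; first exact: measurable_set1.
  exact: lebesgue_measure_set1.
by move=> t /= /negP; rewrite negbK => /eqP.
Qed.

Lemma shift_quotient x (a t : R) :
  (fun h : R => h^-1 *: (x (h *: (1 : R) + t - a) - x (t - a))) =
  (fun h : R => h^-1 *: (x (h *: (1 : R) + (t - a)) - x (t - a))).
Proof. by apply/funext => h; rewrite addrA. Qed.

Lemma derivable_shift x (a t : R) :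
  derivable (fun s => x (s - a)) t 1 -> derivable x (t - a) 1.
Proof. by rewrite /derivable /= shift_quotient. Qed.

Lemma derive_shift x (a t : R) : 'D_1 (fun s => x (s - a)) t = 'D_1 x (t - a).
Proof. by rewrite /derive /= shift_quotient. Qed.

Lemma near_eq_derive_mx x x' (t : R) : {near t, x =1 x'} ->
  derivable x t 1 -> derivable x' t 1 /\ 'D_1 x' t = 'D_1 x t.
Proof.
move=> xx' xd; split; first exact: near_eq_derivable xd.
by apply/esym/near_eq_derive.
Qed.

(** A Lipschitz solution on a bounded interval J has an end value z, where a
    local solution takes over. The assumptions on the neighborhood of z are
    made for all cluster points z of x, since the end value is constructed
    in the proof. *)
Lemma solution_extends D J x (M r G : R) :
  filippov_solution D g J x -> has_ubound J -> 0 <= M ->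
  (forall s t, J s -> J t -> s <= t -> `|x t - x s| <= M * (t - s)) ->
  0 < r -> 0 <= G ->
  (forall z, (forall d : R, 0 < d -> exists2 t, J t & `|z - x t| <= d) ->
     [/\ forall y, `|y - z| <= r -> D y,
         forall y, `|y - z| <= r -> `|g y| <= G &
         forall y (e : R), `|y - z| <= r -> 0 < e ->
           exists y', `|y' - y| < e /\ {for y', continuous g}]) ->
  exists J' x', [/\ filippov_solution D g J' x', J `<=` J',
    forall t, J t -> x' t = x t & J' <> J].
Proof.
move=> xsol Jub M0 xM r0 G0 hz.
have [[Jitv J0 Jge [t1 Jt1 t10]] xD xac xae] := xsol.
have Jn0 : J !=set0 by exists 0.
have Js : has_sup J by split.
pose a := sup J.
have Ja t : J t -> t <= a by move=> Jt; exact: ub_le_sup.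
have a0 : 0 < a := lt_le_trans t10 (Ja _ Jt1).
have aJ t : 0 <= t -> t < a -> J t.
  move=> t0 ta; have ta0 : 0 < a - t by rewrite subr_gt0.
  have [s Jss sa] := sup_adherent ta0 Js; rewrite -/a subKr in sa; apply: (Jitv 0 s) => //; rewrite t0 ltW//.
have zent i j : exists l, forall t, J t -> `|l - x t i j| <= M * (a - t).
  apply: (lipschitz_end_value Jn0 Ja) => // s t Jss Jtt st.
  have := xM _ _ Jss Jtt st; apply: le_trans.
  by have := normr_entry_le (x t - x s) i j; rewrite !mxE.
pose z : 'M[R]_(m, n) := \matrix_(i, j) sval (cid (zent i j)).
have zx t : J t -> `|z - x t| <= M * (a - t).
  move=> Jt; apply: mxnorm_le => [|i j]; first by rewrite mulr_ge0// subr_ge0 Ja.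
  by rewrite !mxE; exact: (svalP (cid (zent i j)) t Jt).
have [|zD zG zreg] := hz z.
  move=> d d0; have M1 : 0 < M + 1 by rewrite ltr_wpDl.
  have [t Jt ta] := sup_adherent (divr_gt0 d0 M1) Js.
  exists t => //; rewrite (le_trans (zx _ Jt))//.
  move: ta; rewrite -/a ltrBlDr -ltrBlDl ltr_pdivlMr// => ta.
  have := Ja _ Jt; nra.
have [y [y0 yL yF]] := filippov_local_existence G0 zG zreg.
(* up to time h the local solution stays within distance r of z *)
pose h := r / (G + 1).
have h0 : 0 < h by rewrite divr_gt0// ltr_wpDl.
have Gh : G * h < r.
  by rewrite /h mulrA ltr_pdivrMr ?ltr_wpDl// mulrC ltr_pM2l// ltrDl.
have NJ t : 0 <= t -> ~ J t -> a <= t.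
  by move=> t0 Jt; rewrite leNgt; apply/negP => ta; apply: Jt; exact: aJ.
pose x' t := if pselect (J t) then x t else y (t - a).
have x'J t : J t -> x' t = x t by rewrite /x'; case: pselect.
have x'N t : ~ J t -> x' t = y (t - a) by rewrite /x'; case: pselect.
pose J' := [set t : R | 0 <= t <= a + h].
have JJ' : J `<=` J'.
  by move=> t Jt; rewrite /J'/= Jge//= (le_trans (Ja _ Jt))// lerDl ltW.
have x'L s t : 0 <= s -> s <= t -> t <= a + h -> `|x' t - x' s| <= (M + G) * (t - s).
  move=> s0 st tah; have t0 := le_trans s0 st.
  have ts0 : 0 <= t - s by rewrite subr_ge0.
  have [Jss|Jss] := pselect (J s); have [Jtt|Jtt] := pselect (J t).
  - rewrite !x'J// (le_trans (xM _ _ Jss Jtt st))// ler_wpM2r// lerDl//.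
  - rewrite (x'J s)// (x'N t)// -(subrKA z) (le_trans (ler_normD _ _))//.
    have ta := NJ _ t0 Jtt; have sa := Ja _ Jss.
    have ta0 : 0 <= t - a by rewrite subr_ge0.
    have := yL 0 (t - a) (lexx 0) ta0; rewrite y0 subr0.
    have := zx _ Jss; nra.
  - have sa := NJ _ s0 Jss; have ta := Ja _ Jtt.
    by case: Jss; rewrite (_ : s = t)//; apply/le_anti; rewrite st (le_trans ta).
  - have sa := NJ _ s0 Jss; rewrite !x'N// (le_trans (yL _ _ _ _))//.
    + by rewrite subr_ge0.
    + by rewrite lerD2r.
    + rewrite (_ : t - a - (s - a) = t - s); last by ring.
      by rewrite ler_wpM2r// lerDr.
exists J', x'; split => //; last first.
  move=> J'J; have : J' (a + h) by rewrite /J'/= lexx addr_ge0// ltW.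
  by rewrite J'J => /Ja; rewrite gerDl leNgt h0.
split.
- split.
  + move=> s t /= /andP[s0 sa] /andP[t0 ta] u /andP[su ut]; rewrite /J'/=.
    by rewrite (le_trans s0 su) (le_trans ut ta).
  + by rewrite /J'/= lexx addr_ge0// ltW.
  + by move=> t /= /andP[].
  + by exists a => //; rewrite /J'/= (ltW a0) lerDl ltW.
- move=> t /andP[t0 tah]; have [Jt|Jt] := pselect (J t); first by rewrite x'J//; exact: xD.
  rewrite x'N//; apply: zD; have ta := NJ _ t0 Jt.
  have ta0 : 0 <= t - a by rewrite subr_ge0.
  have := yL 0 (t - a) (lexx 0) ta0; rewrite y0 subr0 => /le_trans; apply.
  rewrite ltW// (le_lt_trans _ Gh)// ler_wpM2l//; lra.
- move=> b /andP[b0 bah]; apply: (@lipschitz_absolutely_continuous _ (M + G)).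
    exact: addr_ge0.
  by move=> s t s0 st tb; apply: x'L => //; exact: le_trans bah.
have aeF : Filter (almost_everywhere mu) := ae_filter_ringOfSetsType mu.
have x'd : {ae mu, forall t, 0 < t < a + h -> derivable x' t 1}.
  have ent (ij : 'I_m * 'I_n) : {ae mu, forall t, 0 < t < a + h ->
      derivable (fun t => x' t ij.1 ij.2) t 1}.
    apply: (@lipschitz_derivable_ae R _ 0 (a + h) (M + G)) => s t s0 st tb.
    apply: le_trans (x'L _ _ s0 st tb).
    by have := normr_entry_le (x' t - x' s) ij.1 ij.2; rewrite !mxE.
  have entf : {ae mu, forall t, forall ij : 'I_m * 'I_n, 0 < t < a + h ->
      derivable (fun t => x' t ij.1 ij.2) t 1} by apply: filter_forall.
  by apply: filterS entf => t ht t0; apply/derivable_mxP => i j; exact: (ht (i, j)).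
apply: filterS2 (filterI (ae_neq 0) (filterI (ae_neq a) (ae_neq (a + h)))) (filterI xae x'd).
move=> t [t0 [ta tah]] [xt x't] /andP[tge0 tle].
have {}t0 : 0 < t by rewrite lt_def t0.
have {}tah : t < a + h by rewrite lt_neqAle tah.
have x'dt : derivable x' t 1 by apply: x't; rewrite t0.
have [{}ta|at_] : t < a \/ a < t by move: ta; rewrite neq_lt => /orP.
  have Jt := aJ t (ltW t0) ta; have [xd xF] := xt Jt.
  have E : {near t, x =1 x'}.
    near=> s; rewrite x'J//; apply: aJ.
      by apply: ltW; near: s; exact: lt_nbhsr.
    by near: s; exact: lt_nbhsl.
  have [d1 d2] := near_eq_derive_mx E xd; split => //; rewrite d2 x'J//.
have ntJ s : a < s -> ~ J s by move=> as_ /Ja; rewrite leNgt as_.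
have E : {near t, x' =1 (fun s => y (s - a))}.
  by near=> s; rewrite x'N//; apply: ntJ; near: s; exact: lt_nbhsr.
have [d1 d2] := near_eq_derive_mx E x'dt; split => //.
rewrite -d2 derive_shift x'N; last exact: ntJ.
apply: yF; first by rewrite subr_gt0.
  by rewrite (le_lt_trans _ Gh)// ler_wpM2l//; lra.
exact: derivable_shift d1.
Unshelve. all: by end_near. Qed.

Lemma absolutely_continuous_cvg_left x (b : R) : 0 < b ->
  absolutely_continuous_on 0 b x -> x t @[t --> b^'-] --> x b.
Proof.
move=> b0 xac; apply/cvgrPdist_lt => eps eps0.
have [d d0 hd] := xac _ eps0; near=> t.
rewrite (le_lt_trans (mxnorm_le_enorm _))//.
have t0 : 0 < t by near: t; exact: nbhs_left_gt.
have tb : t < b by near: t; exact: nbhs_left_lt.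
have tbd : b - t < d by near: t; exact: nbhs_left_ltBl.
by have := hd [:: (t, b)]; rewrite /= !big_seq1/= (ltW t0) (ltW tb) lexx => /(_ isT isT tbd).
Unshelve. all: by end_near. Qed.

End SolutionExtension.

(** * Disagreement on a connected graph *)

Section ConsensusGraph.
Context {R : realType} {m n : nat} (e : rel 'I_n).
Hypothesis e_sym : symmetric e.
Implicit Types x y z : 'M[R]_(m, n).

(** The argument of f_i in the equation of agent i. *)
Definition pull x (i : 'I_n) : 'cV[R]_m :=
  \sum_(j in neighbors e i) (col j x - col i x).

(** The oriented incidence matrix of the graph, with both orientations of
    every edge; the pairs that are not edges give zero columns. *)
Definition edge_mx : 'M[R]_(n, #|{: 'I_n * 'I_n}|) :=
  \matrix_(l, k) let: (i, j) := enum_val k in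
    (e i j)%:R * ((l == i)%:R - (l == j)%:R).

(** The square is twice the quadratic form of the graph Laplacian. As a
    Euclidean norm of a linear image of x, the disagreement inherits
    Lipschitz continuity and subgradients. *)
Definition disagreement x : R := enorm (x *m edge_mx).

Lemma col_mul_edge_mx x i j :
  col (enum_rank (i, j)) (x *m edge_mx) = (e i j)%:R *: (col i x - col j x).
Proof.
apply/matrixP => k l; rewrite !mxE.
under eq_bigr do rewrite mxE enum_rankK mulrCA mulrBr.
rewrite -mulr_sumr sumrB; congr (_ * (_ - _)).
  by rewrite (bigD1 i)//= eqxx mulr1 big1 ?addr0// => a /negbTE ->; rewrite mulr0.
by rewrite (bigD1 j)//= eqxx mulr1 big1 ?addr0// => a /negbTE ->; rewrite mulr0.
Qed.

Lemma frob_edge_mx x z : frob (x *m edge_mx) (z *m edge_mx) =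
  \sum_i \sum_(j | e i j) frob (col i x - col j x) (col i z - col j z).
Proof.
rewrite frob_colE (reindex (@enum_rank _)); last first.
  by exists enum_val => k _; rewrite ?enum_rankK ?enum_valK.
rewrite (eq_bigr (fun p : 'I_n * 'I_n => (e p.1 p.2)%:R *
    frob (col p.1 x - col p.2 x) (col p.1 z - col p.2 z))); last first.
  case=> i j _; rewrite !col_mul_edge_mx frobZl frobZr mulrA -natrM mulnb andbb//.
rewrite -(pair_bigA _ (fun i j => (e i j)%:R * frob (col i x - col j x) (col i z - col j z)))/=.
apply: eq_bigr => i _; rewrite [RHS]big_mkcond/=; apply: eq_bigr => j _.
by case: (e i j); rewrite ?mul1r ?mul0r.
Qed.

Lemma frob_sumr (I : Type) (r : seq I) (P : pred I) (F : I -> 'cV[R]_m) (u : 'cV[R]_m) :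
  frob u (\sum_(i <- r | P i) F i) = \sum_(i <- r | P i) frob u (F i).
Proof. by apply: (big_morph _ (frobDr u)); rewrite frob0r. Qed.

Lemma pullE x i : pull x i = \sum_(j | e i j) (col j x - col i x).
Proof. by apply: eq_bigl => j; rewrite inE. Qed.

(** Summation by parts on the graph: up to a factor, the pulls are the
    gradient of the squared disagreement. *)
Lemma frob_edge_pull x z :
  frob (x *m edge_mx) (z *m edge_mx) = -2 * \sum_i frob (pull x i) (col i z).
Proof.
rewrite frob_edge_mx.
have -> : \sum_i \sum_(j | e i j) frob (col i x - col j x) (col i z - col j z) =
   \sum_i \sum_(j | e i j) frob (col i x - col j x) (col i z) +
   \sum_i \sum_(j | e i j) frob (col j x - col i x) (col j z).
  rewrite -big_split/=; apply: eq_bigr => i _; rewrite -big_split/=; apply: eq_bigr => j _.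
  have -> : col j x - col i x = - (col i x - col j x) by rewrite opprB.
  by rewrite frobBr (frobC (- _)) frobNr (frobC (col j z)).
rewrite [X in _ + X](exchange_big_dep xpredT)//=.
have E i : \sum_(j | e j i) frob (col i x - col j x) (col i z) =
    \sum_(j | e i j) frob (col i x - col j x) (col i z).
  by apply: eq_bigl => j; rewrite e_sym.
rewrite (eq_bigr _ (fun i _ => E i)) -mulr2n mulNr -[in RHS]mulrN mulr_natl.
congr (_ *+ _); rewrite -sumrN; apply: eq_bigr => i _.
rewrite pullE frobC -frobNr frobC -sumrN [in RHS]frobC frob_sumr.
by apply: eq_bigr => j _; rewrite opprB frobC.
Qed.

(** Pairing with a state in which all agents agree, whose edge differences
    vanish. *)
Lemma sum_pull x : \sum_i pull x i = 0.
Proof.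
apply/eqP; rewrite -enorm_eq0 -sqrf_eq0 enorm_sqr frob_sumr.
set u := \sum_i pull x i.
have := frob_edge_pull x (\matrix_(k, i) u k 0).
have uE i : col i (\matrix_(k, i) u k 0) = u :> 'cV[R]_m.
  by apply/matrixP => k l; rewrite !mxE (ord1 l).
rewrite frob_edge_mx big1 => [|i _]; last first.
  by rewrite big1// => j _; rewrite !uE subrr frob0r.
move=> /esym/eqP; rewrite mulf_eq0 oppr_eq0 pnatr_eq0/= => /eqP h.
by rewrite -[X in _ == X]h; apply/eqP/eq_bigr => i _; rewrite uE frobC.
Qed.

(** As all pulls add up to zero, the pull on a single exceptional agent is
    balanced by the pulls on the others. *)
Lemma sum_pull_le x (A : {set 'I_n}) : (#|A| <= 1)%N ->
  \sum_i enorm (pull x i) <= 2 * \sum_(i | i \notin A) enorm (pull x i).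
Proof.
move=> A1.
have tri (P : pred 'I_n) : enorm (\sum_(i | P i) pull x i) <= \sum_(i | P i) enorm (pull x i).
  elim/big_ind2: _ => [|u a v b ua vb|//]; first by rewrite enorm0.
  by rewrite (le_trans (ler_enormD _ _))// lerD.
have AE : \sum_(i in A) enorm (pull x i) = enorm (\sum_(i in A) pull x i).
  move: A1; rewrite leq_eqVlt ltnS leqn0 cards_eq0 => /orP[/cards1P[i ->]|/eqP ->].
    by rewrite !big_set1.
  by rewrite !big_set0 enorm0.
have SA : \sum_(i in A) pull x i = - \sum_(i | i \notin A) pull x i.
  by apply/eqP; rewrite -addr_eq0 -(bigID (mem A) xpredT)/= sum_pull.
rewrite (bigID (mem A) xpredT)/= AE SA enormN.
have := tri [pred i | i \notin A]; rewrite /=; lra.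
Qed.

Lemma disagreement_lipschitz : exists2 L : R, 0 <= L &
  forall x y, disagreement x - disagreement y <= L * enorm (x - y).
Proof.
have [L L0 hL] := @mulmx_bounded R m n _ edge_mx; exists L => // x y.
by rewrite (le_trans (ler_dist_enorm _ _))// -mulmxBl hL.
Qed.

Hypothesis e_conn : forall i j, connect e i j.

Lemma edge_le_disagreement x i j : e i j -> enorm (col i x - col j x) <= disagreement x.
Proof.
move=> eij; rewrite -(@ler_pXn2r _ 2)// ?nnegrE ?enorm_ge0// !enorm_sqr frob_edge_mx.
rewrite (bigD1 i)//= (bigD1 j)//= -addrA lerDl addr_ge0//.
  by apply: sumr_ge0 => k _; exact: frob_ge0.
by apply: sumr_ge0 => k _; apply: sumr_ge0 => l _; exact: frob_ge0.
Qed.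

(** A simple path from i to j has at most n edges. *)
Lemma dist_le_disagreement x i j : enorm (col i x - col j x) <= n%:R * disagreement x.
Proof.
have /connectP[p ep ->] := e_conn i j.
case/shortenP : ep => p' ep' up' _.
have : (size p' <= n)%N.
  by rewrite -[X in (_ <= X)%N](card_ord n) (leq_trans _ (max_card (mem (i :: p'))))// (card_uniqP up')/=.
move=> pn; apply: (@le_trans _ _ ((size p')%:R * disagreement x)); last first.
  by rewrite ler_wpM2r ?enorm_ge0// ler_nat.
elim: p' i ep' {up' pn} => [|k p' IH] i /=; first by rewrite subrr enorm0 mul0r.
move=> /andP[eik ekp]; rewrite -(subrKA (col k x)) (le_trans (ler_enormD _ _))//.
by rewrite -natr1 mulrDl mul1r addrC lerD ?IH// edge_le_disagreement.
Qed.

(** As the pulls add up to zero, the squared disagreement is -2 times the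
    sum of the pairings of pull_i with x_i - x_k, for any fixed k, and each
    |x_i - x_k| is at most n times the disagreement. *)
Lemma disagreement_le_pull x : disagreement x <= 2 * n%:R * \sum_i enorm (pull x i).
Proof.
have [->|d0] := eqVneq (disagreement x) 0.
  by rewrite mulr_ge0// sumr_ge0// => i _; exact: enorm_ge0.
have {}d0 : 0 < disagreement x by rewrite lt_def d0 enorm_ge0.
have [k _|n0] := pickP 'I_n; last first.
  have := d0; rewrite /disagreement enorm_gt0 => /eqP[]; apply/matrixP => a b.
  by rewrite !mxE big1// => l; have := n0 l.
rewrite -(ler_pM2l d0) -expr2 /disagreement enorm_sqr frob_edge_pull -/(disagreement x).
have -> : \sum_i frob (pull x i) (col i x) = \sum_i frob (pull x i) (col i x - col k x).
  under [in RHS]eq_bigr do rewrite frobBr.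
  rewrite sumrB; under [X in _ - X]eq_bigr do rewrite frobC.
  by rewrite -frob_sumr sum_pull frob0r subr0.
rewrite mulNr -mulrN -sumrN.
rewrite [leRHS](_ : _ = 2 * \sum_i (enorm (pull x i) * (n%:R * disagreement x))); last first.
  by rewrite -mulr_suml; ring.
rewrite ler_pM2l//; apply: ler_sum => i _; rewrite -frobNr.
rewrite (le_trans (frob_le_enorm _ _))// enormN ler_wpM2l ?enorm_ge0//.
exact: dist_le_disagreement.
Qed.

Lemma disagreement_eq0 x i j : disagreement x = 0 -> col i x = col j x.
Proof.
move=> d0; apply/eqP; rewrite -subr_eq0 -enorm_eq0 eq_le enorm_ge0 andbT.
by rewrite (le_trans (dist_le_disagreement x i j))// d0 mulr0.
Qed.

Definition maxcol x : R := \big[Order.max/0]_i enorm (col i x).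

Lemma enorm_col_le_maxcol x i : enorm (col i x) <= maxcol x.
Proof. exact: (le_bigmax _ (fun i => enorm (col i x)) i). Qed.

Lemma maxcol_le x (c : R) : 0 <= c -> (forall i, enorm (col i x) <= c) -> maxcol x <= c.
Proof. by move=> c0 h; apply: bigmax_le. Qed.

Lemma maxcol_ge0 x : 0 <= maxcol x.
Proof. exact: bigmax_ge_id. Qed.

Lemma maxcol_lipschitz x y : maxcol x - maxcol y <= enorm (x - y).
Proof.
rewrite lerBlDl; apply: maxcol_le => [|i]; first by rewrite addr_ge0 ?maxcol_ge0 ?enorm_ge0.
have -> : col i x = col i y + col i (x - y) by apply/matrixP => k l; rewrite !mxE; ring.
rewrite (le_trans (ler_enormD _ _))// lerD ?enorm_col_le_maxcol//; exact: enorm_col_le.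
Qed.

(** If every outermost agent had all its neighbors at its own position, then
    by connectedness all agents would be there. A point x_j other than x_i
    in the ball of radius |x_i| satisfies x_i . x_j < |x_i|^2. *)
Lemma outermost_pulled_inwards x :
  ~ (exists v, forall i, col i x = v) -> exists i,
  [/\ enorm (col i x) = maxcol x, 0 < maxcol x & frob (col i x) (pull x i) < 0].
Proof.
move=> xC.
have [k _|n0] := pickP 'I_n; last by case: xC; exists 0 => i; have := n0 i.
have m0 : 0 < maxcol x.
  rewrite lt_def maxcol_ge0 andbT; apply/eqP => h; apply: xC; exists 0 => i.
  by apply/eqP; rewrite -enorm_eq0 eq_le enorm_ge0 andbT -h enorm_col_le_maxcol.
have [i0 i0m] : exists i, enorm (col i x) = maxcol x.
  apply: contrapT => h; suff : maxcol x < maxcol x by rewrite ltxx.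
  apply: bigmax_lt => // i _; rewrite lt_neqAle enorm_col_le_maxcol andbT.
  by apply/eqP => hi; apply: h; exists i.
have [i [im [j eij xij]]] : exists i, enorm (col i x) = maxcol x /\
    exists2 j, e i j & col j x != col i x.
  apply: contrapT => h; apply: xC; exists (col i0 x) => i.
  have /connectP[p ep ->] := e_conn i0 i.
  elim: p i0 i0m ep => [//|j p IH] i1 i1m /= /andP[e1j ejp].
  have E : col j x = col i1 x.
    apply/eqP; apply: contrapT => /negP xj; apply: h; exists i1; split => //.
    by exists j.
  by rewrite -E IH// E.
exists i; split => //; rewrite pullE frob_sumr (bigD1 j)//=.
have le0 l : frob (col i x) (col l x - col i x) <= 0.
  rewrite frobBr subr_le0 (le_trans (frob_le_enorm _ _))// -enorm_sqr expr2.
  by rewrite ler_wpM2l ?enorm_ge0// im enorm_col_le_maxcol.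
have lt0 : frob (col i x) (col j x - col i x) < 0.
  have : 0 < frob (col j x - col i x) (col j x - col i x).
    by rewrite -enorm_sqr exprn_gt0// enorm_gt0 subr_eq0.
  have : enorm (col j x) ^+ 2 <= enorm (col i x) ^+ 2.
    by rewrite lerXn2r ?nnegrE ?enorm_ge0// im enorm_col_le_maxcol.
  rewrite !enorm_sqr frobBl !frobBr (frobC (col j x) (col i x)); lra.
by rewrite -[ltRHS]addr0 ltr_leD// sumr_le0.
Qed.

End ConsensusGraph.

(** * The Jacobian of the axis-angle coordinates *)

Section Sinc.
Context {R : realType}.
Implicit Types r s : R.

(** The difference has derivative s sin s. *)
Lemma mulr_cos_le_sin s : 0 <= s <= pi -> s * cos s <= sin s.
Proof.
move=> /andP[]; rewrite le_eqVlt => /predU1P[<-|s0] spi; first by rewrite mul0r sin0.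
have [||c] := @MVT R (fun u => sin u - u * cos u) (fun u => u * sin u) 0 s s0.
- move=> u us; apply: is_derive_eq.
  by rewrite /GRing.scale/= mulr1; ring.
- apply: continuous_subspaceT => u; apply: cvgB; first exact: continuous_sin.
  by apply: cvgM; [exact: cvg_id|exact: continuous_cos].
rewrite in_itv/= sin0 mul0r !subr0 => /andP[c0 cs] h.
rewrite -subr_ge0 h !mulr_ge0 ?(ltW c0) ?(ltW s0)// sin_ge0_pi// (ltW c0)/=.
exact: le_trans (ltW cs) spi.
Qed.

Lemma sin_le_id s : 0 <= s -> sin s <= s.
Proof.
rewrite le_eqVlt => /predU1P[<-|s0]; first by rewrite sin0.
have [|c] := @MVT R sin cos 0 s s0.
  by apply: continuous_subspaceT => u; exact: continuous_sin.
by move=> _; rewrite sin0 !subr0 => ->; rewrite ler_piMl ?(ltW s0) ?cos_le1.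
Qed.

(** The derivative of sin s / s is (s cos s - sin s) / s^2. *)
Lemma sin_div_antitone s r : 0 < s -> s <= r -> r <= pi -> sin r / r <= sin s / s.
Proof.
move=> s0; rewrite le_eqVlt => /predU1P[->//|sr] rpi.
have [||c] := @MVT R (fun u => sin u / u) (fun u => (u * cos u - sin u) / u ^+ 2) s r sr.
- move=> u; rewrite in_itv/= => /andP[su _].
  have u0 : u != 0 by rewrite gt_eqF// (lt_trans s0).
  have := is_deriveM (is_derive_sin u) (is_deriveV u0 (is_derive_id u 1)).
  rewrite (_ : _ + _ = (u * cos u - sin u) / u ^+ 2)//.
  by rewrite /GRing.scale/=; field.
- apply: continuous_in_subspaceT => u; rewrite inE/= in_itv/= => /andP[su _].
  apply: cvgM; first exact: continuous_sin.
  by apply: cvgV; [rewrite gt_eqF// (lt_le_trans s0)|exact: cvg_id].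
rewrite in_itv/= => /andP[sc cr] h; rewrite -subr_le0 h.
rewrite mulr_le0_ge0 ?subr_ge0 ?(ltW sr)// mulr_le0_ge0 ?invr_ge0 ?sqr_ge0//.
rewrite subr_le0 mulr_cos_le_sin// (ltW (lt_trans s0 sc))/=.
exact: le_trans (ltW cr) rpi.
Qed.

Lemma sinc_ratio r : 0 < r < 2 * pi ->
  sinc r / sinc (r / 2) ^+ 2 = (r / 2) * cos (r / 2) / sin (r / 2).
Proof.
move=> /andP[r0 r2]; rewrite /sinc !gt_eqF ?divr_gt0//.
have s0 : sin (r / 2) != 0.
  by rewrite gt_eqF// sin_gt0_pi// divr_gt0//= ltr_pdivrMr// mulrC.
have -> : sin r = 2 * sin (r / 2) * cos (r / 2).
  by rewrite [in LHS](splitr r) sinD; ring.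
by field; rewrite s0 gt_eqF.
Qed.

(** With s = r / 2 the ratio is s cos s / sin s, and sin s <= s. *)
Lemma cos_half_le_sinc_ratio r rho : 0 < r -> r <= rho -> rho < pi ->
  cos (rho / 2) <= sinc r / sinc (r / 2) ^+ 2.
Proof.
move=> r0 rrho rhopi; have pi0 := @pi_gt0 R.
rewrite sinc_ratio; last by rewrite r0/=; lra.
have s0 : 0 < r / 2 by rewrite divr_gt0.
have sin0 : 0 < sin (r / 2) by apply: sin_gt0_pi; rewrite s0/=; lra.
have c0 : 0 <= cos (r / 2) by apply: cos_ge0_pihalf; lra.
have c1 : cos (rho / 2) <= cos (r / 2).
  move: rrho; rewrite le_eqVlt => /predU1P[->//|h].
  by apply: ltW; rewrite ltr_cos ?in_itv/=; lra.
rewrite ler_pdivlMr// mulrC.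
have := sin_le_id (ltW s0); nra.
Qed.

(** With s = r / 2 the ratio is s cos s / sin s, and s / sin s is largest at
    the end of the range. *)
Lemma sinc_ratio_bounded rho : rho < 2 * pi -> exists2 C : R, 0 <= C &
  forall r, 0 < r <= rho -> `|sinc r / sinc (r / 2) ^+ 2| <= C.
Proof.
move=> rho2; have pi0 := @pi_gt0 R.
have [rho0|rho0] := leP rho 0.
  by exists 0 => // r /andP[r0 /le_trans/(_ rho0)]; rewrite leNgt r0.
have srho : 0 < sin (rho / 2) by apply: sin_gt0_pi; rewrite divr_gt0//=; lra.
exists ((rho / 2) / sin (rho / 2)); first by rewrite divr_ge0 ?ltW// divr_gt0.
move=> r /andP[r0 rrho]; rewrite sinc_ratio; last by rewrite r0/=; lra.
have s0 : 0 < r / 2 by rewrite divr_gt0.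
have sr : 0 < sin (r / 2) by apply: sin_gt0_pi; rewrite s0/=; lra.
have h : sin (rho / 2) / (rho / 2) <= sin (r / 2) / (r / 2).
  by apply: sin_div_antitone => //; lra.
have h' : (r / 2) / sin (r / 2) <= (rho / 2) / sin (rho / 2).
  by rewrite -[leLHS]invf_div -[leRHS]invf_div lef_pV2// posrE !divr_gt0.
rewrite mulrAC normrM (ger0_norm (ltW (divr_gt0 s0 sr))).
apply: le_trans h'; rewrite ler_piMr ?cos_max// ltW// divr_gt0//.
Qed.

Lemma continuous_sinc : continuous (@sinc R).
Proof.
move=> a; have [->|a0] := eqVneq a 0; last first.
  have h : (fun u : R => sin u / u) @ a --> sinc a.
    rewrite /sinc (negbTE a0); apply: cvgM; first exact: continuous_sin.
    by apply: cvgV => //; exact: cvg_id.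
  apply: cvg_trans h; apply: near_eq_cvg; near=> u.
  have : 0 < `|u|.
    near: u; apply: (@cvgr_gt _ _ _ _ (fun u : R => `|u|) `|a|); last by rewrite normr_gt0.
    by apply: cvg_norm; exact: cvg_id.
  by rewrite normr_gt0 /sinc => /negbTE ->.
have D : (fun h : R => h^-1 *: (sin (h *: (1 : R) + 0) - sin 0)) @ (0 : R)^' --> (1 : R).
  have := @is_derive_sin R 0 => -[d1 d2]; rewrite -[X in _ --> X](cos0 R) -d2.
  exact: d1.
have sinc0 : sinc 0 = 1 :> R by rewrite /sinc eqxx.
rewrite /continuous_at sinc0; apply/cvgrPdist_lt => e e0.
move/cvgrPdist_lt : D => /(_ _ e0) D.
have {}D : \forall u \near (0 : R), u != 0 ->
  `|1 - u^-1 *: (sin (u *: (1 : R) + 0) - sin 0)| < e := D.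
apply: filterS D => u hu; rewrite /sinc; case: eqVneq => [_|u0]; first by rewrite subrr normr0.
by have := hu u0; rewrite sin0 subr0 addr0 /GRing.scale/= mulr1 mulrC.
Unshelve. all: by end_near. Qed.

End Sinc.

Section CrossProduct.
Context {R : realType}.
Implicit Types p q w : 'cV[R]_3.

Lemma frob3 p q : frob p q = p 0 0 * q 0 0 + p 1 0 * q 1 0 + p 2 0 * q 2 0.
Proof.
rewrite /frob; under eq_bigr do rewrite big_ord1.
rewrite !big_ord_recl big_ord0 addr0 addrA.
by congr (_ + _ * _ + _ * _); congr (_ _ _); apply/val_inj.
Qed.

Lemma hat_mulE p w : hat p *m w = \col_(i < 3) nth 0
  [:: p 1 0 * w 2 0 - p 2 0 * w 1 0; p 2 0 * w 0 0 - p 0 0 * w 2 0;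
      p 0 0 * w 1 0 - p 1 0 * w 0 0] i.
Proof.
apply/matrixP => i j; rewrite (ord1 j) !mxE !big_ord_recl big_ord0 !mxE/=.
have -> : lift ord0 ord0 = 1 :> 'I_3 by apply/val_inj.
have -> : lift ord0 (lift ord0 ord0) = 2 :> 'I_3 by apply/val_inj.
by case: i => -[|[|[|//]]] i /=; ring.
Qed.

Lemma frob_hat p w : frob w (hat p *m w) = 0.
Proof. by rewrite frob3 hat_mulE !mxE/=; ring. Qed.

Lemma frob_hat_self p w : frob p (hat p *m w) = 0.
Proof. by rewrite frob3 hat_mulE !mxE/=; ring. Qed.

Lemma enorm_hat_le p w : enorm (hat p *m w) <= enorm p * enorm w.
Proof.
rewrite -(@ler_pXn2r _ 2)// ?nnegrE ?mulr_ge0 ?enorm_ge0// exprMn !enorm_sqr.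
suff -> : frob (hat p *m w) (hat p *m w) = frob p p * frob w w - frob p w ^+ 2.
  by rewrite gerBl sqr_ge0.
by rewrite !frob3 hat_mulE !mxE/=; ring.
Qed.

Lemma hatB p q : hat (p - q) = hat p - hat q.
Proof.
apply/matrixP => i j; rewrite !mxE.
by case: i => -[|[|[|//]]] i; case: j => -[|[|[|//]]] j /=; rewrite ?subr0 ?mxE; ring.
Qed.

Lemma hat_tr p : (hat p)^T = - hat p.
Proof.
apply/matrixP => i j; rewrite !mxE.
by case: i => -[|[|[|//]]] i; case: j => -[|[|[|//]]] j /=; rewrite ?oppr0 ?opprK.
Qed.

Lemma continuous_hat : continuous (@hat R).
Proof.
apply: (@lipschitz_continuous _ _ _ _ 1) => p q; rewrite -hatB mul1r.
set v := p - q; apply: mxnorm_le => [|i j]; first exact: normr_ge0.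
by rewrite mxE; case: i => -[|[|[|//]]] i; case: j => -[|[|[|//]]] j /=;
  rewrite ?normr0 ?normr_ge0 ?normrN ?normr_entry_le.
Qed.

Lemma hat_cube p : hat p ^+ 3 = - (enorm p ^+ 2) *: hat p.
Proof.
rewrite exprS expr2 -!mulmxE enorm_sqr frob3.
apply/matrixP => i j; rewrite !mxE !big_ord_recl big_ord0 !mxE !big_ord_recl !big_ord0 !mxE/=.
by case: i => -[|[|[|//]]] i; case: j => -[|[|[|//]]] j /=; ring.
Qed.

End CrossProduct.

Section AttitudeJacobian.
Context {R : realType}.
Implicit Types p q w : 'cV[R]_3.

Let ratio p := sinc (enorm p) / sinc (enorm p / 2) ^+ 2.

Lemma Lmx_mulE p w : p != 0 -> Lmx p *m w =
  ratio p *: w + ((1 - ratio p) / enorm p ^+ 2 * frob p w) *: p + 2^-1 *: (hat p *m w).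
Proof.
move=> p0; rewrite /Lmx (negbTE p0) -/(ratio p) !mulmxDl mul_scalar_mx -!scalemxAl.
rewrite -mulmxA (_ : p^T *m w = (frob p w)%:M).
  by rewrite mul_mx_scalar scalerA.
by apply/matrixP => i j; rewrite !ord1 [RHS]mxE eqxx mulr1n -dotvE.
Qed.

(** L_p fixes p, and so does its transpose: the radial component of a
    velocity is that of f_i. *)
Lemma frob_Lmx_self p w : frob p (Lmx p *m w) = frob p w.
Proof.
have [->|p0] := eqVneq p 0; first by rewrite !frob0l.
rewrite Lmx_mulE// !frobDr !frobZr frob_hat_self -enorm_sqr.
by field; rewrite enorm_eq0.
Qed.

(** The symmetric part of L_p is the identity on the line through p and the
    scalar (r / 2) cot (r / 2), r = |p|, on the orthogonal plane. *)
Lemma frob_Lmx_ge p w rho : rho < pi -> enorm p <= rho ->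
  cos (rho / 2) * enorm w ^+ 2 <= frob w (Lmx p *m w).
Proof.
move=> rhopi prho; have rho0 : 0 <= rho by rewrite (le_trans _ prho)// enorm_ge0.
have [->|p0] := eqVneq p 0.
  rewrite /Lmx eqxx mul1mx -enorm_sqr ler_piMl ?sqr_ge0//; exact: cos_le1.
have n0 : 0 < enorm p by rewrite enorm_gt0.
rewrite Lmx_mulE// !frobDr !frobZr frob_hat mulr0 addr0 -enorm_sqr (frobC w).
have := cos_half_le_sinc_ratio n0 prho rhopi; rewrite -/(ratio p).
have c1 := cos_le1 (rho / 2).
set a := ratio p; set c := cos _ in c1 *; move=> ca.
have -> : a * enorm w ^+ 2 + (1 - a) / enorm p ^+ 2 * frob p w * frob p w =
    a * (enorm w ^+ 2 - (frob p w / enorm p) ^+ 2) + (frob p w / enorm p) ^+ 2.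
  by field; rewrite gt_eqF.
have : (frob p w / enorm p) ^+ 2 <= enorm w ^+ 2.
  rewrite -real_normK ?num_real// lerXn2r ?nnegrE ?enorm_ge0//.
  rewrite normrM normfV (gtr0_norm n0) ler_pdivrMr// mulrC; exact: normr_frob_le.
have := sqr_ge0 (frob p w / enorm p); have := sqr_ge0 (enorm w).
set X := _ ^+ 2; set Y := _ ^+ 2 => X0 Y0 YX.
by nra.
Qed.

Lemma Lmx_bounded rho : rho < 2 * pi -> exists2 C : R, 0 <= C &
  forall p w, enorm p <= rho -> enorm (Lmx p *m w) <= C * enorm w.
Proof.
move=> rho2; have [C C0 hC] := sinc_ratio_bounded rho2.
exists (2 * C + 1 + `|rho|); first by rewrite !addr_ge0// mulr_ge0.
move=> p w prho; have w0 := enorm_ge0 w.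
have [->|p0] := eqVneq p 0.
  by rewrite /Lmx eqxx mul1mx ler_peMl// -addrA addrCA lerDl addr_ge0// mulr_ge0.
have n0 : 0 < enorm p by rewrite enorm_gt0.
have aC : `|ratio p| <= C by apply: hC; rewrite n0.
have -> : (2 * C + 1 + `|rho|) * enorm w = C * enorm w + (1 + C) * enorm w + `|rho| * enorm w.
  by ring.
rewrite Lmx_mulE// (le_trans (ler_enormD _ _))// lerD//.
  rewrite (le_trans (ler_enormD _ _))// !enormZ.
  have a1 : `|1 - ratio p| <= 1 + C.
    by rewrite (le_trans (ler_normB _ _))// normr1 lerD2l.
  apply: lerD; first by rewrite ler_wpM2r.
  rewrite !normrM normfV (ger0_norm (sqr_ge0 _)).
  have h : `|frob p w| <= enorm p * enorm w := normr_frob_le p w.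
  rewrite (_ : _ * enorm p = `|1 - ratio p| * (`|frob p w| / enorm p)).
    by rewrite ler_pM ?divr_ge0 ?enorm_ge0// ler_pdivrMr// mulrC.
  by field; rewrite gt_eqF.
rewrite enormZ normfV ger0_norm// ler_pdivrMl//.
rewrite (le_trans (enorm_hat_le _ _))// mulrA ler_wpM2r//.
rewrite (le_trans prho)// (le_trans (ler_norm _))// ler_peMl// ler1n//.
Qed.

Lemma continuous_Lmx_entry p k l : p != 0 -> enorm p < 2 * pi ->
  {for p, continuous (fun q => Lmx q k l)}.
Proof.
move=> p0 p2; have n0 : 0 < enorm p by rewrite enorm_gt0.
have FF : Filter (nbhs p) := nbhs_filter p.
have cn : enorm q @[q --> p] --> enorm p by exact: continuous_enorm.
have cr : ratio q @[q --> p] --> ratio p.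
  have c1 : sinc (enorm q) @[q --> p] --> sinc (enorm p).
    have fc := @continuous_sinc R.
    refine (continuous_cvg _ (fc (enorm p)) cn).
  apply: (cvgM c1); apply: cvgV.
    have h0 : 0 < enorm p / 2 by rewrite divr_gt0.
    rewrite expf_neq0// /sinc (gt_eqF h0) gt_eqF// divr_gt0//.
    by apply: sin_gt0_pi; rewrite h0/= ltr_pdivrMr// mulrC.
  rewrite expr2; under eq_fun do rewrite expr2.
  have cs : sinc (enorm q / 2) @[q --> p] --> sinc (enorm p / 2).
    have c2 : enorm q / 2 @[q --> p] --> enorm p / 2 by apply: cvgM cn _; exact: cvg_cst.
    have fc := @continuous_sinc R.
    refine (continuous_cvg _ (fc (enorm p / 2)) c2).
  exact: (cvgM cs cs).
have ce i : (fun q : 'cV[R]_3 => q i 0) @ p --> p i 0 by exact: continuous_entry.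
have ch : hat q k l @[q --> p] --> hat p k l.
  have ee := @continuous_entry R 3 3 k l (hat p).
  refine (continuous_cvg _ ee (@continuous_hat R p)).
have main : (fun q => ratio q * (k == l)%:R + (1 - ratio q) / (enorm q * enorm q) * (q k 0 * q l 0)
    + 2^-1 * hat q k l) @ p -->
    ratio p * (k == l)%:R + (1 - ratio p) / (enorm p * enorm p) * (p k 0 * p l 0) + 2^-1 * hat p k l.
  have nn : enorm p * enorm p != 0 by rewrite mulf_neq0 ?gt_eqF.
  have t0 : (fun q => (1 - ratio q) / (enorm q * enorm q)) @ p -->
      (1 - ratio p) / (enorm p * enorm p).
    have tb : (fun q => 1 - ratio q) @ p --> 1 - ratio p by apply: cvgB => //; exact: cvg_cst.
    by apply: (cvgM tb); apply: cvgV => //; exact: (cvgM cn cn).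
  have t1 : (fun q => ratio q * (k == l)%:R) @ p --> ratio p * (k == l)%:R.
    by apply: (cvgM cr); exact: cvg_cst.
  have t2 : (fun q : 'cV[R]_3 => q k 0 * q l 0) @ p --> p k 0 * p l 0.
    exact: (cvgM (ce k) (ce l)).
  have t3 : (fun q => 2^-1 * hat q k l) @ p --> 2^-1 * hat p k l.
    by apply: cvgM ch; exact: cvg_cst.
  exact: (cvgD (cvgD t1 (cvgM t0 t2)) t3).
have E q : q != 0 -> Lmx q k l = ratio q * (k == l)%:R +
    (1 - ratio q) / (enorm q * enorm q) * (q k 0 * q l 0) + 2^-1 * hat q k l.
  move=> q0; rewrite /Lmx (negbTE q0) -/(ratio q) mxE mxE mxE mxE mxE big_ord1 mxE.
  by congr (_ + _ + _); [rewrite mulr_natr|rewrite mxE].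
suff : (fun q => Lmx q k l) @ p --> Lmx p k l by [].
rewrite E//; apply: cvg_trans main; apply: near_eq_cvg.
have : \forall q \near p, 0 < enorm q by apply: (cvgr_gt (enorm p) cn).
by apply: filterS => q; rewrite enorm_gt0 => q0; rewrite E.
Qed.

End AttitudeJacobian.

(** * The exponential map of SO(3) *)

Section RotationExponential.
Context {R : realType}.
Implicit Types p : 'cV[R]_3.

(** Rodrigues' formula for the rotation with axis-angle vector p. The
    coefficient (1 - cos r) / r^2 is written with sinc, which makes it
    continuous at p = 0. *)
Definition rodrigues p : 'M[R]_3 :=
  1 + sinc (enorm p) *: hat p + (sinc (enorm p / 2) ^+ 2 / 2) *: hat p ^+ 2.

Lemma hat_exp_odd p k : hat p ^+ k.*2.+1 = (- enorm p ^+ 2) ^+ k *: hat p.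
Proof.
elim: k => [|k IH]; first by rewrite expr1 scale1r.
rewrite -[k.+1.*2.+1]/(2 + k.*2.+1)%N exprD IH -scalerAr -exprSr hat_cube scalerA.
by rewrite -exprSr.
Qed.

Lemma hat_exp_even p k : hat p ^+ k.+1.*2 = (- enorm p ^+ 2) ^+ k *: hat p ^+ 2.
Proof. by rewrite doubleS exprSr hat_exp_odd -scalerAl -expr2. Qed.

(** The even powers of hat p from the second on are multiples of hat p ^ 2,
    and the constant term of the cosine series has to be taken out; this is
    what the summands with k = 0 do. *)
Lemma exp_hat_term p k : p != 0 -> (k`!%:R)^-1 *: hat p ^+ k =
  (k == 0%N)%:R *: 1 + (sin_coeff (enorm p) k / enorm p) *: hat p
  + (((k == 0%N)%:R - cos_coeff (enorm p) k) / enorm p ^+ 2) *: hat p ^+ 2.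
Proof.
rewrite -enorm_gt0 => n0; set a := enorm p in n0 *.
have a0 : a != 0 by rewrite gt_eqF.
have [l [->|->]] : exists l, k = l.*2 \/ k = l.*2.+1.
  exists k./2; rewrite -{1 3}(odd_double_half k); case: (odd k) => /=; [right|left];
  by rewrite ?add0n ?add1n.
- rewrite sin_coeff_even mul0r scale0r addr0.
  case: l => [|l].
    have c0 : cos_coeff a 0%N = 1 by rewrite /cos_coeff /= fact0 !expr0 !mul1r invr1.
    rewrite -[0.*2]/0%N c0 eqxx fact0 invr1 expr0 /=.
    by rewrite !scale1r subrr mul0r scale0r addr0.
  rewrite hat_exp_even -/a /= scale0r add0r sub0r scalerA; congr (_ *: _).
  rewrite -cos_coeff'E /cos_coeff' -exprnP.
  rewrite exprNn -exprM doubleS !exprS mulnC muln2.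
  by field; rewrite a0 /= pnatr_eq0 -lt0n fact_gt0.
- rewrite cos_coeff_odd /= subr0 mul0r scale0r scale0r add0r addr0 hat_exp_odd -/a scalerA.
  congr (_ *: _); rewrite -sin_coeff'E /sin_coeff' -exprnP.
  rewrite exprNn -exprM mulnC muln2 exprS.
  by field; rewrite a0 /= pnatr_eq0 -lt0n fact_gt0.
Qed.

Lemma one_minus_cos_sinc (a : R) : a != 0 ->
  (1 - cos a) / a ^+ 2 = sinc (a / 2) ^+ 2 / 2.
Proof.
move=> a0; rewrite /sinc mulf_eq0 invr_eq0 (negbTE a0) pnatr_eq0/=.
rewrite {1}(splitr a) cosD -expr2 -expr2 cos2sin2.
by field.
Qed.

(** Since hat p ^ 3 = - |p|^2 hat p, the exponential series of hat p splits
    into the series of sin |p| and cos |p|. *)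
Lemma expmx_hat p : expmx (hat p) = rodrigues p.
Proof.
rewrite /expmx /rodrigues; apply: cvg_lim; first exact: norm_hausdorff.
have [->|p0] := eqVneq p 0.
  have h0 : hat (0 : 'cV[R]_3) = 0 by have := hatB (0 : 'cV[R]_3) 0; rewrite !subrr.
  rewrite h0 expr0n /= !scaler0 !addr0; apply: cvg_near_cst.
  near=> k; have k0 : (0 < k)%N by near: k; exists 1%N.
  rewrite /series/= -(prednK k0) big_nat_recl//= fact0 invr1 scale1r expr0.
  by rewrite big1 ?addr0// => j _; rewrite expr0n/= scaler0.
have a0 : enorm p != 0 by rewrite enorm_eq0.
have E : series (fun k => (k`!%:R)^-1 *: hat p ^+ k) =
   fun N => (series (fun k => (k == 0%N)%:R) N) *: (1 : 'M[R]_3) +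
     (series (sin_coeff (enorm p)) N / enorm p) *: hat p +
     ((series (fun k => (k == 0%N)%:R) N - series (cos_coeff (enorm p)) N) / enorm p ^+ 2) *: hat p ^+ 2.
  apply/funext => N; rewrite /series/=.
  under eq_bigr do rewrite exp_hat_term//.
  rewrite !big_split/= -!scaler_suml; congr (_ + _ *: _ + _ *: _).
  by rewrite sumrB.
have c1 : series (fun k : nat => (k == 0%N)%:R : R) @ \oo --> (1 : R).
  apply: cvg_near_cst; near=> k; have k0 : (0 < k)%N by near: k; exists 1%N.
  by rewrite /series/= -(prednK k0) big_nat_recl//= big1 ?addr0.
have cs : series (sin_coeff (enorm p)) @ \oo --> sin (enorm p).
  by rewrite sin.unlock; exact: is_cvg_series_sin_coeff.
have cc : series (cos_coeff (enorm p)) @ \oo --> cos (enorm p).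
  by rewrite cos.unlock; exact: is_cvg_series_cos_coeff.
rewrite E -one_minus_cos_sinc// (_ : sinc (enorm p) = sin (enorm p) / enorm p); last first.
  by rewrite /sinc (negbTE a0).
rewrite -[1 as X in X + _ + _]scale1r.
apply: cvgD; first apply: cvgD.
- by apply: cvgZl.
- by apply: cvgZl; apply: cvgM => //; exact: cvg_cst.
- by apply: cvgZl; apply: cvgM; [exact: cvgB|exact: cvg_cst].
Unshelve. all: by end_near. Qed.

Lemma rodrigues_mul (A : 'M[R]_3) (c a b a' b' : R) : A ^+ 3 = - c *: A ->
  (1 + a *: A + b *: A ^+ 2) * (1 + a' *: A + b' *: A ^+ 2) =
  1 + (a + a' - (a * b' + b * a') * c) *: A +
    (b + b' + a * a' - b * b' * c) *: A ^+ 2.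
Proof.
move=> A3; have A4 : A ^+ 4 = - c *: A ^+ 2 by rewrite exprSr A3 -scalerAl -expr2.
set P := a + a' - _; set Q := b + b' + _ - _.
rewrite !mulrDl !mulrDr !mul1r !mulr1 -!scalerAl -!scalerAr !scalerA.
rewrite -expr2 -exprS -exprSr -exprD A3 A4 !scalerA.
apply/matrixP => i j; rewrite !mxE /P /Q; ring.
Qed.

(** A rotation is the square of the rotation by half the angle, which forces
    its determinant to be 1. *)
Lemma rodrigues_half_double p :
  rodrigues p = (1 + (sin (enorm p / 2) / enorm p) *: hat p +
    ((1 - cos (enorm p / 2)) / enorm p ^+ 2) *: hat p ^+ 2) ^+ 2.
Proof.
rewrite expr2 (rodrigues_mul _ _ _ _ (hat_cube p)) /rodrigues.
have [->|p0] := eqVneq p 0.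
  have h0 : hat (0 : 'cV[R]_3) = 0 by have := hatB (0 : 'cV[R]_3) 0; rewrite !subrr.
  by rewrite h0 expr0n/= !scaler0.
rewrite -enorm_eq0 in p0; rewrite -one_minus_cos_sinc// /sinc (negbTE p0).
set a := enorm p in p0 *.
have c2 := cos2sin2 (a / 2).
congr (_ + _ *: _ + _ *: _).
  by rewrite [in sin a](splitr a) sinD; field: c2.
by rewrite [in cos a](splitr a) cosD; field: c2.
Qed.

Lemma rodrigues_orthogonal p a b :
  2 * b + b ^+ 2 * - enorm p ^+ 2 - a ^+ 2 = 0 ->
  let E : 'M[R]_3 := 1 + a *: hat p + b *: hat p ^+ 2 in E *m E^T = 1%:M.
Proof.
move=> ab E.
have -> : E^T = 1 + (- a) *: hat p + b *: hat p ^+ 2.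
  rewrite /E !linearD !linearZ/= -[1]/(1%:M : 'M[R]_3) trmx1 hat_tr expr2 -mulmxE.
  by rewrite trmx_mul hat_tr mulNmx mulmxN opprK scalerN scaleNr.
change (E * (1 + (- a) *: hat p + b *: hat p ^+ 2) = 1); rewrite /E (rodrigues_mul _ _ _ _ (hat_cube p)).
rewrite (_ : a + - a - _ = 0); last by ring.
rewrite (_ : b + b + a * - a - _ = 0); first by rewrite !scale0r !addr0.
by rewrite -[RHS]ab; ring.
Qed.

Lemma rodrigues_SO3 p : SO3 (rodrigues p).
Proof.
split.
  apply: rodrigues_orthogonal; rewrite /sinc mulf_eq0 invr_eq0 pnatr_eq0 orbF.
  have [->|a0] := eqVneq (enorm p) 0; first by field.
  rewrite [in sin (enorm p)](splitr (enorm p)) sinD.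
  by have := cos2sin2 (enorm p / 2) => c2; field: c2.
have [p0|p0] := eqVneq p 0.
  have h0 : hat (0 : 'cV[R]_3) = 0 by have := hatB (0 : 'cV[R]_3) 0; rewrite !subrr.
  by rewrite /rodrigues p0 h0 expr0n/= !scaler0 !addr0 det1.
rewrite -enorm_eq0 in p0.
rewrite rodrigues_half_double expr2 -mulmxE det_mulmx -expr2.
set F := 1 + _ + _.
have : F *m F^T = 1%:M.
  apply: rodrigues_orthogonal; have := cos2sin2 (enorm p / 2) => c2; by field: c2.
by move=> /(congr1 determinant); rewrite det_mulmx det_tr det1 expr2.
Qed.

Lemma cvg_rodrigues p : rodrigues q @[q --> p] --> rodrigues p.
Proof.
have ch := @continuous_hat R p.
have cn : enorm q @[q --> p] --> enorm p by exact: continuous_enorm.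
have cn2 : enorm q / 2 @[q --> p] --> enorm p / 2 by apply: cvgM cn _; exact: cvg_cst.
have fc := @continuous_sinc R.
have c1 : sinc (enorm q) @[q --> p] --> sinc (enorm p).
  refine (continuous_cvg _ (fc (enorm p)) cn).
have c2 : sinc (enorm q / 2) @[q --> p] --> sinc (enorm p / 2).
  refine (continuous_cvg _ (fc (enorm p / 2)) cn2).
have che i j : hat q i j @[q --> p] --> hat p i j.
  refine (continuous_cvg _ (@continuous_entry _ _ _ i j (hat p)) ch).
have FF : Filter (nbhs p) := nbhs_filter p.
apply: (@cvg_mx _ _ _ _ (nbhs p) rodrigues _ FF) => i j.
have entryE q : rodrigues q i j = (i == j)%:R + sinc (enorm q) * hat q i j +
    (sinc (enorm q / 2) * sinc (enorm q / 2) / 2) * (\sum_k hat q i k * hat q k j).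
  by rewrite /rodrigues expr2 expr2 -mulmxE [X in fun_of_matrix (X + _ + _)](_ : 1 = 1%:M)// !mxE.
under eq_fun do rewrite entryE; rewrite entryE.
apply: cvgD; first by apply: cvgD; [exact: cvg_cst|apply: cvgM => //; exact: che].
apply: cvgM; first by apply: cvgM; [exact: (cvgM c2 c2)|exact: cvg_cst].
by apply: cvg_big => [|k _]; [exact: add_continuous|exact: (cvgM (che i k) (che k j))].
Qed.

End RotationExponential.

(** * The attitude field *)

Section ContinuousBounded.
Context {R : realType}.

(** A sequence along which a continuous function is unbounded would converge
    along an ultrafilter, to a point near which the function is bounded. *)
Lemma continuous_bounded {m n m' n' : nat} (h : 'M[R]_(m, n) -> 'M[R]_(m', n')) (r : R) :
  continuous h -> exists2 M : R, 0 <= M & forall y, enorm y <= r -> enorm (h y) <= M.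
Proof.
move=> hc; apply: contrapT => H.
have {}H (k : nat) : exists y, enorm y <= r /\ k%:R < enorm (h y).
  apply: contrapT => Hk; apply: H; exists k%:R => // y yr.
  by rewrite leNgt; apply/negP => hy; apply: Hk; exists y.
pose y k := sval (cid (H k)).
have yP k : enorm (y k) <= r /\ k%:R < enorm (h (y k)) := svalP (cid (H k)).
have [U [UU Usub]] := @ultraFilterLemma nat \oo _.
have PU : ProperFilter U by exact: ultra_proper.
have [|l yl] := @ultra_bounded_mx R m n nat U y r UU.
  by move=> k; rewrite (le_trans (mxnorm_le_enorm _))//; have [] := yP k.
have hl : (fun k => enorm (h (y k))) @ U --> enorm (h l).
  have h1 : (fun k => h (y k)) @ U --> h l by refine (continuous_cvg _ (hc l) yl).
  by refine (continuous_cvg _ (@continuous_enorm R m' n' (h l)) h1).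
have n1 : \forall k \near U, enorm (h (y k)) < enorm (h l) + 1.
  by apply: (cvgr_lt (enorm (h l)) hl); rewrite ltrDl.
have n2 : \forall k \near U, enorm (h l) + 1 <= k%:R.
  by apply: Usub; exact: nbhs_infty_ger.
have [k [k1 k2]] := filter_ex (filterI n1 n2).
have [_ k3] := yP k; by have := lt_trans k3 (lt_le_trans k1 k2); rewrite ltxx.
Qed.

Lemma poly_nonroot (p : {poly R}) (d : R) : p != 0 -> 0 < d ->
  exists2 s, 0 < s < d & p.[s] != 0.
Proof.
move=> p0 d0; apply: contrapT => H.
pose rs := [seq d / k.+2%:R | k <- iota 0 (size p)].
have := @max_poly_roots _ p rs p0; rewrite size_map size_iota ltnn => h.
have : false; last by []. apply: h.
  apply/allP => _ /mapP[k _ ->]; apply: contrapT => /negP nr; apply: H.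
  exists (d / k.+2%:R); last by [].
  by rewrite divr_gt0//= ltr_pdivrMr// ltr_pMr// ltr1n.
rewrite map_inj_uniq ?iota_uniq// => i j /(mulfI (lt0r_neq0 d0))/invr_inj.
by move/eqP; rewrite eqr_nat => /eqP[].
Qed.

(** The case of equality in Cauchy-Schwarz. *)
Lemma direction_of_frob {m : nat} (u y : 'cV[R]_m) : y != 0 ->
  frob u y = enorm u * enorm y -> u = (enorm u / enorm y) *: y.
Proof.
move=> y0 uy; have ny : enorm y != 0 by rewrite enorm_eq0.
have : enorm (enorm y *: u - enorm u *: y) == 0.
  rewrite -sqrf_eq0 enorm_sqr frobBl !frobBr !frobZl !frobZr (frobC y) uy -!enorm_sqr.
  by apply/eqP; ring.
rewrite enorm_eq0 subr_eq0 => /eqP h.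
by rewrite mulrC -scalerA -h scalerA mulVf// scale1r.
Qed.

Lemma continuous_dsign {m : nat} (y : 'cV[R]_m) : y != 0 -> {for y, continuous (@dsign R m)}.
Proof.
move=> y0; have FF : Filter (nbhs y) := nbhs_filter y.
have ny : enorm y != 0 by rewrite enorm_eq0.
have cn : enorm w @[w --> y] --> enorm y by exact: continuous_enorm.
suff : @dsign R m @ y --> dsign y by [].
have h : (fun w : 'cV[R]_m => (enorm w)^-1 *: w) @ y --> (enorm y)^-1 *: y.
  by apply: cvgZ; [exact: cvgV|exact: cvg_id].
rewrite {2}/dsign (negbTE y0); apply: cvg_trans h; apply: near_eq_cvg.
have : \forall q \near y, 0 < enorm q by apply: (cvgr_gt (enorm y) cn); rewrite enorm_gt0.
by apply: filterS => q; rewrite enorm_gt0 /dsign => /negbTE ->.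
Qed.

Lemma locally_lipschitz_continuous {m : nat} (h : 'cV[R]_m -> 'cV[R]_m) :
  locally_lipschitz h -> continuous h.
Proof.
move=> hl y; have [U Uy [M [Mr hM]]] := hl y.
have FF : Filter (nbhs y) := nbhs_filter y.
suff : h @ y --> h y by [].
have M1 : M < `|M| + 1 by rewrite ltr_pwDr// ler_norm.
apply/cvgrPdist_lt => eps eps0.
have K0 : 0 < `|M| + 1 by rewrite ltr_wpDl.
have n1 : \forall w \near y, `|y - w| < eps / (`|M| + 1).
  by have := nbhsx_ballx y _ (divr_gt0 eps0 K0); rewrite -ball_normE.
apply: filterS (filterI Uy n1) => w [Uw yw].
have := hM _ M1 (y, w); rewrite /= => /(_ _)/wrap[].
  by split => //; exact: nbhs_singleton.
move=> /le_lt_trans; apply; rewrite mulrC -ltr_pdivlMr//.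
Qed.

End ContinuousBounded.

Section AttitudeField.
Context {R : realType} {n : nat}.
Variables (e : rel 'I_n) (f : 'I_n -> 'cV[R]_3 -> 'cV[R]_3) (Ic : {set 'I_n}).
Hypotheses (e_sym : symmetric e) (e_irr : irreflexive e)
  (e_conn : forall i j, connect e i j) (e_nbr : forall i, exists j, e i j)
  (n_gt0 : (0 < n)%N).
Hypotheses (f_dir : forall i y, exists2 l : R, 0 <= l & f i y = l *: y)
  (f_unit : forall i y, i \notin Ic -> y != 0 -> enorm (f i y) = 1)
  (f_bounded : forall r : R, exists2 M : R, 0 <= M &
     forall i y, enorm y <= r -> enorm (f i y) <= M)
  (f_cont : forall i y, y != 0 -> {for y, continuous (f i)}).
Implicit Types x y z w : 'M[R]_(3, n).

Local Notation g := (attitude_field e f).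
Local Notation pull := (pull e).
Local Notation disagreement := (disagreement e).

Lemma col_attitude_field x i : col i (g x) = Lmx (col i x) *m f i (pull x i).
Proof. by apply/matrixP => k l; rewrite (ord1 l) !mxE. Qed.

Lemma enorm_pull_le x i : enorm (pull x i) <= n%:R * (2 * maxcol x).
Proof.
rewrite pullE.
apply: (@le_trans _ _ (\sum_(j | e i j) (2 * maxcol x))).
  elim/big_ind2 : _ => [|a b c d ab cd|j _]; first by rewrite enorm0.
    by rewrite (le_trans (ler_enormD _ _))// lerD.
  by rewrite (le_trans (ler_enormB _ _))// mulr_natl mulr2n lerD// enorm_col_le_maxcol.
apply: (@le_trans _ _ (\sum_(j < n) (2 * maxcol x))).
  by rewrite big_mkcond/=; apply: ler_sum => j _; case: ifP; rewrite // mulr_ge0// maxcol_ge0.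
by rewrite sumr_const card_ord [leRHS]mulr_natl.
Qed.

Lemma field_bounded (rho : R) : rho < 2 * pi -> exists2 G : R, 0 <= G &
  forall x, maxcol x <= rho -> forall i, enorm (col i (g x)) <= G.
Proof.
move=> rho2; have [C C0 hC] := Lmx_bounded rho2.
have [M M0 hM] := f_bounded (n%:R * (2 * rho)).
exists (C * M); first exact: mulr_ge0.
move=> x xrho i; rewrite col_attitude_field (le_trans (hC _ _ _))//.
  exact: le_trans (enorm_col_le_maxcol _ _) xrho.
rewrite ler_wpM2l// hM// (le_trans (enorm_pull_le _ _))//.
by rewrite ler_wpM2l// ler_wpM2l.
Qed.

Lemma maxcol_continuous : continuous (@maxcol R 3 n).
Proof.
apply: (@lipschitz_continuousR _ _ _ (3 * n).+1%:R) => x y.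
exact: le_trans (maxcol_lipschitz x y) (enorm_le_mxnorm _).
Qed.

Lemma near_maxcol_lt x (rho : R) : maxcol x < rho -> \forall y \near nbhs x, maxcol y < rho.
Proof. by move=> h; apply: (cvgr_lt (maxcol x)) => //; exact: maxcol_continuous. Qed.

Lemma near_enorm_lt x (c : R) : 0 < c -> \forall y \near nbhs x, enorm (x - y) < c.
Proof.
move=> c0; have := enorm_ball_nbhs x c0; apply: filterS => y.
by rewrite /eball/= enorm_distC.
Qed.

Lemma continuous_entry_prod x (i j k : 'I_n) (l l' : 'I_3) :
  (fun y : 'M[R]_(3, n) => y l i * (y l' j - y l' k)) @ x --> x l i * (x l' j - x l' k).
Proof.
have FF : Filter (nbhs x) := nbhs_filter x.
have h a b : (fun y : 'M[R]_(3, n) => y a b) @ x --> x a b by exact: continuous_entry.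
exact: (cvgM (h _ _) (cvgB (h _ _) (h _ _))).
Qed.

Lemma frob_col_pull_cvg x i :
  (fun y => frob (col i y) (pull y i)) @ x --> frob (col i x) (pull x i).
Proof.
have FF : Filter (nbhs x) := nbhs_filter x.
have E y : frob (col i y) (pull y i) =
    \sum_(j | e i j) \sum_k y k i * (y k j - y k i).
  rewrite pullE frob_sumr; apply: eq_bigr => j _; apply: eq_bigr => k _.
  by rewrite big_ord1 !mxE.
under eq_fun do rewrite E; rewrite E.
apply: cvg_big => [|j _]; first exact: add_continuous.
apply: cvg_big => [|k _]; first exact: add_continuous.
exact: continuous_entry_prod.
Qed.

Lemma frob_Lmx_pull_le (p q : 'cV[R]_3) i :
  frob p q <= 0 -> frob p (Lmx p *m f i q) <= 0.
Proof.
move=> pq; rewrite frob_Lmx_self; have [l l0 ->] := f_dir i q.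
by rewrite frobZr mulr_ge0_le0.
Qed.

Definition single_col i (u : 'cV[R]_3) : 'M[R]_(3, n) :=
  \matrix_(k, j) (if j == i then u k 0 else 0).

Lemma frob_single_col i u z : frob (single_col i u) z = frob u (col i z).
Proof.
rewrite frob_colE (bigD1 i)//= big1 ?addr0.
  by congr frob; apply/matrixP => k l; rewrite !mxE eqxx (ord1 l).
move=> j /negbTE ji; rewrite [col j _](_ : _ = 0) ?frob0l//.
by apply/matrixP => k l; rewrite !mxE ji.
Qed.

(** An outermost agent that is pulled strictly inwards keeps being so
    nearby, and L_p leaves the component along p unchanged. Other outermost
    agents, if they share the position of all their neighbors, may have
    velocities in the Filippov set that point outwards; this does no harm,
    as one subgradient of the maximum is enough. *)
Lemma field_inward x : maxcol x < 2 * pi -> ~ consensus_space x ->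
  exists2 A, forall z, maxcol x + frob A (z - x) <= maxcol z &
             forall w, filippov g x w -> frob A w <= 0.
Proof.
move=> x2 xC; have [i [im m0 inw]] := outermost_pulled_inwards e_conn xC.
have xi0 : 0 < enorm (col i x) by rewrite im.
exists (single_col i ((enorm (col i x))^-1 *: col i x)).
  move=> z; rewrite frob_single_col; apply: le_trans (enorm_col_le_maxcol z i).
  rewrite -im linearB; apply: enorm_subgradient; exact: lt0r_neq0.
apply: filippov_le => // eps eps0.
(* any bound between the largest norm and 2 pi, where the field is bounded *)
pose rho := (maxcol x + 2 * pi) / 2.
have xrho : maxcol x < rho by rewrite /rho; lra.
have [|G G0 hG] := @field_bounded rho; first by rewrite /rho; lra.
have n1 := near_maxcol_lt xrho.
have n2 : \forall y \near nbhs x, frob (col i y) (pull y i) < 0.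
  by apply: (cvgr_lt _ (@frob_col_pull_cvg x i)).
have n3 : \forall y \near nbhs x, enorm (x - y) < eps * enorm (col i x) / (G + 1).
  by apply: near_enorm_lt; rewrite divr_gt0 ?mulr_gt0// ltr_wpDl.
apply: filterS3 n1 n2 n3 => y y1 y2 y3.
rewrite frob_single_col frobZl add0r ler_pdivrMl//.
have -> : frob (col i x) (col i (g y)) =
    frob (col i y) (col i (g y)) + frob (col i (x - y)) (col i (g y)).
  by rewrite linearB frobBl addrC subrK.
have h1 : frob (col i y) (col i (g y)) <= 0.
  by rewrite col_attitude_field; apply: frob_Lmx_pull_le; exact: ltW.
have h2 : frob (col i (x - y)) (col i (g y)) <= enorm (x - y) * G.
  rewrite (le_trans (frob_le_enorm _ _))// ler_pM ?enorm_ge0 ?enorm_col_le//.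
  exact: hG (ltW y1) i.
move: y3; rewrite ltr_pdivlMr ?ltr_wpDl// => y3.
have := enorm_ge0 (x - y); lra.
Qed.

(** The dissipation of agent i is nonnegative, and at least cos (rho / 2)
    |pull_i| if f_i is the signum. The pull on the remaining agent is
    controlled by the others. *)
Lemma sum_frob_pull_ge x (rho : R) : rho < pi -> maxcol x <= rho -> (#|Ic| <= 1)%N ->
  cos (rho / 2) * disagreement x <= 4 * n%:R * \sum_i frob (pull x i) (col i (g x)).
Proof.
move=> rhopi xrho Ic1.
have rho0 : 0 <= rho := le_trans (maxcol_ge0 x) xrho.
have c0 : 0 <= cos (rho / 2) by apply: cos_ge0_pihalf; lra.
have term i : 0 <= frob (pull x i) (col i (g x)) /\
    (i \notin Ic -> cos (rho / 2) * enorm (pull x i) <= frob (pull x i) (col i (g x))).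
  have h := frob_Lmx_ge (pull x i) rhopi (le_trans (enorm_col_le_maxcol x i) xrho).
  rewrite col_attitude_field; have [l l0 fE] := f_dir i (pull x i).
  rewrite fE -scalemxAr frobZr; split.
    by rewrite mulr_ge0// (le_trans _ h)// mulr_ge0// sqr_ge0.
  move=> iIc; have [->|p0] := eqVneq (pull x i) 0; first by rewrite enorm0 mulr0 frob0l mulr0.
  have := f_unit iIc p0; rewrite fE enormZ ger0_norm// => l1.
  have : l * (cos (rho / 2) * enorm (pull x i) ^+ 2) <= l * frob (pull x i) (Lmx (col i x) *m pull x i).
    by rewrite ler_wpM2l.
  apply: le_trans; rewrite mulrCA expr2 (mulrA l) l1 mul1r//.
have s1 : cos (rho / 2) * \sum_(i | i \notin Ic) enorm (pull x i) <=
    \sum_i frob (pull x i) (col i (g x)).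
  rewrite [leRHS](bigID (fun i => i \in Ic))/= mulr_sumr; apply: ler_wpDl.
    by apply: sumr_ge0 => i _; have [] := term i.
  by apply: ler_sum => i iIc; have [_] := term i; exact.
have s2 := sum_pull_le e_sym x Ic1.
have s3 := disagreement_le_pull e_sym e_conn x.
set S := \sum_i enorm _ in s2 s3; set S' := \sum_(i | _) _ in s1 s2.
apply: (@le_trans _ _ (4 * n%:R * (cos (rho / 2) * S'))); last first.
  by rewrite ler_wpM2l ?mulr_ge0.
rewrite mulrCA ler_wpM2l// (le_trans s3)//.
rewrite (_ : 4 * n%:R * S' = 2 * n%:R * (2 * S')); last by ring.
by rewrite ler_wpM2l ?mulr_ge0.
Qed.

(** The subgradient of the disagreement at x is continuous in x away from
    consensus, and its pairing with g is at most a fixed negative multiple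
    of the disagreement divided by the disagreement at x: dividing by the
    norm makes the rate independent of x, which is why consensus is reached
    in finite time. *)
Lemma field_dissipates (rho : R) : rho < pi -> (#|Ic| <= 1)%N -> exists2 k : R, 0 < k &
  forall x, maxcol x < rho -> ~ consensus_space x ->
  exists2 A, forall z, disagreement x + frob A (z - x) <= disagreement z &
             forall w, filippov g x w -> frob A w <= - k.
Proof.
move=> rhopi Ic1; have [rho0|rho0] := leP rho 0.
  by exists 1 => // x /lt_le_trans/(_ rho0); rewrite ltNge maxcol_ge0.
have pi0 := @pi_gt0 R.
have c0 : 0 < cos (rho / 2) by apply: cos_gt0_pihalf; lra.
have n0 : (0 : R) < n%:R by rewrite ltr0n.
exists (cos (rho / 2) / (4 * n%:R)); first by rewrite divr_gt0// mulr_gt0.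
move=> x xrho xC.
have d0 : 0 < disagreement x.
  rewrite lt_def enorm_ge0 andbT; apply/eqP => d0; apply: xC.
  exists (col (Ordinal n_gt0) x) => i; exact: (disagreement_eq0 e_conn).
pose C := (edge_mx e *m (edge_mx e)^T : 'M[R]_n).
have frobC' u z : frob (u *m C) z = frob (u *m edge_mx e) (z *m edge_mx e).
  by rewrite mulmxA frob_mul_tr.
exists ((disagreement x)^-1 *: (x *m C)).
  move=> z; rewrite frobZl frobC' mulmxBl -frobZl.
  by apply: enorm_subgradient; exact: lt0r_neq0.
apply: filippov_le => // eps eps0.
have [|G G0 hG] := @field_bounded rho; first by lra.
have [L L0 hL] := @mulmx_bounded R 3 n n C.
have [D D0 hD] := disagreement_lipschitz e (m := 3) (R := R).
have gE y : maxcol y < rho -> enorm (g y) <= (3 * n).+1%:R * G.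
  move=> yr; rewrite (le_trans (enorm_le_mxnorm _))// ler_wpM2l//.
  apply: mxnorm_le => // k i; apply: le_trans (hG _ (ltW yr) i).
  by have := ler_entry_enorm (col i (g y)) k 0; rewrite mxE.
set G' := (3 * n).+1%:R * G in gE; have G'0 : 0 <= G' by rewrite mulr_ge0.
have n1 := near_maxcol_lt xrho.
(* half of the disagreement at x is given away to continuity, another reason
   for the factor 4 in the rate *)
have n2 : \forall y \near nbhs x, enorm (x - y) < disagreement x / 2 / (D + 1).
  by apply: near_enorm_lt; rewrite !divr_gt0// ltr_wpDl.
have n3 : \forall y \near nbhs x, enorm (x - y) < eps * disagreement x / (L * G' + 1).
  by apply: near_enorm_lt; rewrite divr_gt0 ?mulr_gt0// ltr_wpDl// mulr_ge0.
apply: filterS3 n1 n2 n3 => y y1 y2 y3.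
rewrite frobZl ler_pdivrMl//.
have -> : frob (x *m C) (g y) = frob (y *m C) (g y) + frob ((x - y) *m C) (g y).
  by rewrite mulmxBl frobBl addrC subrK.
have h1 : frob (y *m C) (g y) = -2 * \sum_i frob (pull y i) (col i (g y)).
  by rewrite frobC' frob_edge_pull.
have h2 := sum_frob_pull_ge rhopi (ltW y1) Ic1.
have h3 : disagreement x / 2 <= disagreement y.
  have := hD x y; move: y2; rewrite ltr_pdivlMr ?ltr_wpDl//.
  have := enorm_ge0 (x - y); lra.
have h4 : frob ((x - y) *m C) (g y) <= eps * disagreement x.
  rewrite (le_trans (frob_le_enorm _ _))//.
  apply: (@le_trans _ _ (L * enorm (x - y) * G')).
    by rewrite ler_pM ?enorm_ge0// gE.
  by move: y3; rewrite ltr_pdivlMr ?ltr_wpDl ?mulr_ge0//; have := enorm_ge0 (x - y); lra.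
have h5 : cos (rho / 2) / (4 * n%:R) * disagreement x <= 2 * \sum_i frob (pull y i) (col i (g y)).
  rewrite mulrAC ler_pdivrMr ?mulr_gt0//.
  apply: (@le_trans _ _ (2 * (cos (rho / 2) * disagreement y))).
    by rewrite mulrCA ler_wpM2l ?(ltW c0)//; lra.
  by move: h2; lra.
rewrite h1 mulrDr (mulrC (disagreement x) (- _)) mulNr (mulrC _ eps); lra.
Qed.

(** Adding s^(j + 1) to the first coordinate of x_j turns the first
    coordinates of x_i and of pull_i into nonzero polynomials in s: their
    coefficients of s^(i + 1) are 1 and minus the degree of i. *)
Lemma regular_dense x (d : R) : 0 < d -> exists2 x', `|x' - x| < d &
  forall i, col i x' != 0 /\ pull x' i != 0.
Proof.
move=> d0.
pose P i : {poly R} := (x 0 i)%:P + 'X^(i.+1).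
pose Q i : {poly R} := (pull x i 0 0)%:P + \sum_(j | e i j) ('X^(j.+1) - 'X^(i.+1)).
have P0 i : P i != 0.
  apply/eqP => /(congr1 (fun p : {poly R} => p`_i.+1)); rewrite coefD coefC coefXn eqxx/=.
  by rewrite add0r coef0 => /eqP; rewrite oner_eq0.
have Q0 i : Q i != 0.
  apply/eqP => /(congr1 (fun p : {poly R} => p`_i.+1)); rewrite coefD coefC/= add0r coef0.
  rewrite coef_sum (eq_bigr (fun=> -1)); last first.
    move=> j eij; rewrite coefB !coefXn eqxx eqSS.
    by case: eqP => [/val_inj ij|_]; [move: eij; rewrite -ij e_irr|rewrite sub0r].
  have [j eij] := e_nbr i; rewrite (bigD1 j)//= => h.
  have : \sum_(j' | e i j' && (j' != j)) (-1) <= (0 : R) by apply: sumr_le0 => ? _; rewrite lerN10.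
  lra.
have PQ0 : \prod_i (P i * Q i) != 0.
  by apply/prodf_neq0 => i _; rewrite mulf_neq0.
have [|s /andP[s0 sd] hs] := poly_nonroot (d := Order.min d 1) PQ0.
  by rewrite lt_min d0 ltr01.
move: sd; rewrite lt_min => /andP[sd s1].
pose x' : 'M[R]_(3, n) := \matrix_(k, j) (x k j + (k == 0)%:R * s ^+ j.+1).
have hPQ i : (P i).[s] != 0 /\ (Q i).[s] != 0.
  move: hs; rewrite horner_prod => /prodf_neq0/(_ i isT); rewrite hornerM mulf_eq0 negb_or.
  by move=> /andP[].
exists x'.
  apply: mxnorm_lt => // k j; rewrite !mxE addrAC subrr add0r.
  case: eqP => _; rewrite ?mul0r ?normr0// mul1r ger0_norm ?exprn_ge0 ?(ltW s0)//.
  by apply: le_lt_trans sd; rewrite exprS ler_piMr ?(ltW s0)// exprn_ile1 ?ltW.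
move=> i; have [hP hQ] := hPQ i; split.
  apply: contraNneq hP => /matrixP/(_ 0 0); rewrite !mxE eqxx mul1r => h.
  by rewrite /P hornerD hornerC hornerXn h.
apply: contraNneq hQ => /matrixP/(_ 0 0); rewrite pullE !mxE summxE => h.
rewrite /Q hornerD hornerC horner_sum pullE summxE -big_split/= -[X in _ == X]h; apply/eqP.
by apply: eq_bigr => j _; rewrite !mxE eqxx !mul1r hornerD hornerN !hornerXn; ring.
Qed.

Lemma field_continuous x : maxcol x < 2 * pi ->
  (forall i, col i x != 0 /\ pull x i != 0) -> {for x, continuous g}.
Proof.
move=> x2 xreg; have FF : Filter (nbhs x) := nbhs_filter x.
have ce a b : (fun y : 'M[R]_(3, n) => y a b) @ x --> x a b by exact: continuous_entry.
have ccol i : (fun y : 'M[R]_(3, n) => col i y) @ x --> col i x.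
  by apply: (@cvg_mx _ _ _ _ (nbhs x) _ _ FF) => k l; rewrite mxE; under eq_fun do rewrite mxE; exact: ce.
have cpull i : (fun y => pull y i) @ x --> pull x i.
  apply: (@cvg_mx _ _ _ _ (nbhs x) _ _ FF) => k l.
  have E y : pull y i k l = \sum_(j | e i j) (y k j - y k i).
    by rewrite pullE summxE; apply: eq_bigr => j _; rewrite !mxE.
  under eq_fun do rewrite E; rewrite E.
  apply: cvg_big => [|j _]; first exact: add_continuous.
  exact: (cvgB (ce _ _) (ce _ _)).
suff : g @ x --> g x by [].
apply: (@cvg_mx _ _ _ _ (nbhs x) _ _ FF) => k i.
have E y : g y k i = \sum_l Lmx (col i y) k l * f i (pull y i) l 0.
  by rewrite [LHS]mxE mxE.
under eq_fun do rewrite E; rewrite E.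
have [x0 p0] := xreg i.
have cf : (fun y => f i (pull y i)) @ x --> f i (pull x i).
  refine (continuous_cvg _ (f_cont p0) (cpull i)).
apply: cvg_big => [|l _]; first exact: add_continuous.
apply: cvgM.
  have cL : {for col i x, continuous (fun q => Lmx q k l)}.
    by apply: continuous_Lmx_entry => //; exact: le_lt_trans (enorm_col_le_maxcol _ _) x2.
  refine (@continuous_cvg _ _ _ _ _ _ (fun q : 'cV[R]_3 => Lmx q k l) _ cL (ccol i)).
refine (continuous_cvg _ (@continuous_entry _ _ _ l 0 (f i (pull x i))) cf).
Qed.

End AttitudeField.

(** * Convergence to consensus *)

Section Protocol.
Context {R : realType} {n : nat}.
Variables (e : rel 'I_n) (f : 'I_n -> 'cV[R]_3 -> 'cV[R]_3) (Ic : {set 'I_n}).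
Hypotheses (f_cont : forall i, i \in Ic ->
      [/\ locally_lipschitz (f i), f i 0 = 0 &
          forall y, y != 0 ->
            dotv (f i y) y = enorm (f i y) * enorm y /\
            enorm (f i y) * enorm y != 0])
  (f_sign : forall i, i \notin Ic -> f i = @dsign R 3).

Lemma enorm_dsign (y : 'cV[R]_3) : y != 0 -> enorm (dsign y) = 1.
Proof.
move=> y0; rewrite /dsign (negbTE y0) enormZ ger0_norm ?invr_ge0 ?enorm_ge0//.
by rewrite mulVf// enorm_eq0.
Qed.

Lemma protocol_direction i y : exists2 l : R, 0 <= l & f i y = l *: y.
Proof.
have [iIc|iIc] := boolP (i \in Ic).
  have [_ f0 fy] := f_cont iIc; have [->|y0] := eqVneq y 0.
    by exists 0 => //; rewrite f0 scaler0.
  exists (enorm (f i y) / enorm y); first by rewrite divr_ge0 ?enorm_ge0.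
  by apply: direction_of_frob => //; rewrite -dotvE; have [] := fy y y0.
rewrite (f_sign iIc) /dsign; case: eqVneq => [->|y0]; first by exists 0; rewrite ?scaler0.
by exists (enorm y)^-1 => //; rewrite invr_ge0 enorm_ge0.
Qed.

Lemma protocol_unit i y : i \notin Ic -> y != 0 -> enorm (f i y) = 1.
Proof. by move=> iIc y0; rewrite (f_sign iIc) enorm_dsign. Qed.

Lemma protocol_bounded (r : R) : exists2 M : R, 0 <= M &
  forall i y, enorm y <= r -> enorm (f i y) <= M.
Proof.
have h i : exists M : R, 0 <= M /\ forall y, enorm y <= r -> enorm (f i y) <= M.
  have [iIc|iIc] := boolP (i \in Ic).
    have [fL _ _] := f_cont iIc.
    have [M M0 hM] := continuous_bounded r (locally_lipschitz_continuous fL).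
    by exists M.
  exists 1; split => // y _; rewrite (f_sign iIc).
  have [->|y0] := eqVneq y 0; first by rewrite /dsign eqxx enorm0.
  by rewrite enorm_dsign.
have hP i := svalP (cid (h i)).
exists (\sum_i sval (cid (h i))); first by apply: sumr_ge0 => i _; have [] := hP i.
move=> i y yr; rewrite (le_trans ((hP i).2 y yr))// (bigD1 i)//= lerDl.
by apply: sumr_ge0 => j _; have [] := hP j.
Qed.

Lemma protocol_continuous i y : y != 0 -> {for y, continuous (f i)}.
Proof.
move=> y0; have [iIc|iIc] := boolP (i \in Ic).
  have [fL _ _] := f_cont iIc; exact: locally_lipschitz_continuous fL y.
by rewrite (f_sign iIc); exact: continuous_dsign.
Qed.

Hypotheses (e_sym : symmetric e) (e_irr : irreflexive e)
  (e_conn : forall i j, connect e i j) (n_gt1 : (1 < n)%N) (Ic_le1 : (#|Ic| <= 1)%N).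

Lemma connected_neighbor i : exists j, e i j.
Proof.
have /card_gt0P[j] : (0 < #|predC1 i|)%N by rewrite cardC1 card_ord -ltnS prednK// ltnW.
rewrite !inE => ji; have /connectP[[|k p] /= ep jE] := e_conn i j.
  by rewrite jE eqxx in ji.
by exists k; case/andP: ep.
Qed.

Let n_gt0 : (0 < n)%N. Proof. exact: ltnW. Qed.

Lemma solution_maxcol_le J (x : R -> 'M[R]_(3, n)) :
  filippov_solution state_domain (attitude_field e f) J x ->
  (forall t, J t -> 0 < t -> ~ consensus_space (x t)) ->
  forall t, J t -> maxcol (x t) <= maxcol (x 0).
Proof.
move=> xsol xC t Jt; have [[_ J0 Jge _] xD _ _] := xsol.
have := @solution_decrease R 3 n _ _ J x (@maxcol R 3 n) 1 0 xsol _ _ 0 t J0 Jt (Jge _ Jt).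
rewrite mul0r addr0; apply.
  by move=> y z; rewrite mul1r; exact: maxcol_lipschitz.
move=> s Js s0.
apply: (field_inward e_conn n_gt0 protocol_direction protocol_bounded); last exact: xC.
have pi0 : (0 : R) < 2 * pi by rewrite mulr_gt0 ?pi_gt0.
by apply: bigmax_lt => // i _; exact: (xD s Js i).
Qed.

(** A solution that avoids consensus stays at norm at most rho0 < pi, so
    that its disagreement decreases at a fixed rate; hence its time interval
    is bounded, and the solution can be extended. *)
Lemma maximal_solution_reaches_consensus J (x : R -> 'M[R]_(3, n)) :
  maximal_filippov_solution state_domain (attitude_field e f) J x ->
  (forall i, enorm (col i (x 0)) < pi) ->
  exists T, [/\ J T, 0 < T & consensus_space (x T)].
Proof.
move=> [xsol xmax] x0pi; apply: contrapT => noC.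
have {}noC t : J t -> 0 < t -> ~ consensus_space (x t).
  by move=> Jt t0 xC; apply: noC; exists t.
have pi2 := @pi_ge2 R.
have Mle := solution_maxcol_le xsol noC.
have [[Jitv J0 Jge [t1 Jt1 t10]] xD _ _] := xsol.
set rho0 := maxcol (x 0) in Mle.
have rho0pi : rho0 < pi by apply: bigmax_lt => [|i _]; [exact: pi_gt0|exact: x0pi].
have rho00 : 0 <= rho0 by exact: maxcol_ge0.
pose rho := (rho0 + pi) / 2.
have rho0rho : rho0 < rho by rewrite /rho; lra.
have rhopi : rho < pi by rewrite /rho; lra.
have rho2pi : rho < 2 * pi by lra.
have [G G0 hG] := field_bounded e protocol_bounded rho2pi.
have gG y : maxcol y <= rho -> `|attitude_field e f y| <= G.
  move=> yr; apply: mxnorm_le => // k i; apply: le_trans (hG _ yr i).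
  by have := ler_entry_enorm (col i (attitude_field e f y)) k 0; rewrite mxE.
have [k k0 hk] := field_dissipates e_sym e_conn n_gt0 protocol_direction
  protocol_unit protocol_bounded rhopi Ic_le1.
have [L L0 hL] := disagreement_lipschitz e (m := 3) (R := R).
have Jub : has_ubound J.
  (* later the disagreement would be negative *)
  exists (disagreement e (x 0) / k) => t Jt.
  have := @solution_decrease R 3 n _ _ J x (disagreement e) L (- k) xsol hL _ 0 t J0 Jt (Jge _ Jt).
  rewrite subr0 ler_pdivlMr// => h.
  have {}h : disagreement e (x t) <= disagreement e (x 0) + - k * t.
    apply: h => s Js s0; apply: hk; last exact: noC.
    exact: le_lt_trans (Mle _ Js) rho0rho.
  have := enorm_ge0 (x t *m edge_mx e); rewrite -/(disagreement e (x t)); lra.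
have xM : forall s t, J s -> J t -> s <= t -> `|x t - x s| <= G * (t - s).
  apply: (solution_lipschitz _ n_gt0 xsol) => // t Jt.
  have := near_maxcol_lt (le_lt_trans (Mle _ Jt) rho0rho).
  by apply: filterS => y yr; apply: gG; exact: ltW.
pose N : R := (3 * n).+1%:R; have N0 : 0 < N by rewrite ltr0n.
(* within distance r of a state with largest norm rho0 the norms stay below rho *)
pose r := (rho - rho0) / 2 / N.
have r0 : 0 < r by rewrite !divr_gt0// subr_gt0.
have near_z (z : 'M[R]_(3, n)) d y : maxcol z <= rho0 -> `|y - z| <= d -> maxcol y <= rho0 + N * d.
  move=> zr yz; have := maxcol_lipschitz y z; have := enorm_le_mxnorm (y - z).
  have : N * `|y - z| <= N * d by rewrite ler_pM2l.
  by rewrite /N; lra.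
have [|J' [x' [x'sol JJ' x'x J'J]]] := solution_extends xsol Jub G0 xM r0 G0.
  move=> z hz; have zr : maxcol z <= rho0.
    apply/ler_addgt0Pr => d d0; have [t Jt zt] := hz (d / N) (divr_gt0 d0 N0).
    have := near_z (x t) (d / N) z (Mle _ Jt) zt.
    by rewrite mulrCA divff ?gt_eqF// mulr1.
  have yr y : `|y - z| <= r -> maxcol y <= rho.
    move=> /(near_z _ _ _ zr)/le_trans; apply.
    by rewrite /r mulrCA divff ?gt_eqF// mulr1; lra.
  split.
  - move=> y /yr ylt i; apply: le_lt_trans (enorm_col_le_maxcol y i) _.
    by apply: (le_lt_trans ylt); lra.
  - by move=> y /yr; exact: gG.
  - move=> y d yz d0.
    (* the second bound keeps the norms below rho + 1 < 2 pi *)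
    have d1 : 0 < Order.min d (1 / N) by rewrite lt_min d0 divr_gt0.
    have [y' y'y yreg] := regular_dense e_irr connected_neighbor y d1.
    move: y'y; rewrite lt_min => /andP[y'd y'N].
    have y'2 : maxcol y' < 2 * pi.
      have := maxcol_lipschitz y' y; have := enorm_le_mxnorm (y' - y).
      have : N * `|y' - y| < 1 by rewrite mulrC -ltr_pdivlMr.
      by have := yr _ yz; rewrite /N; lra.
    exists y'; split => //; exact: (field_continuous protocol_continuous y'2 yreg).
exact: J'J (xmax J' x' x'sol JJ' x'x).
Qed.

End Protocol.

Theorem theorem4 (R : realType) (n : nat) (e : rel 'I_n) (Ic : {set 'I_n})
    (f : 'I_n -> 'cV[R]_3 -> 'cV[R]_3)
    (e_sym : symmetric e) (e_irr : irreflexive e)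
    (e_conn : forall i j, connect e i j)
    (f_cont : forall i, i \in Ic ->
      [/\ locally_lipschitz (f i), f i 0 = 0 &
          forall y, y != 0 ->
            dotv (f i y) y = enorm (f i y) * enorm y /\
            enorm (f i y) * enorm y != 0])
    (f_sign : forall i, i \notin Ic -> f i = @dsign R 3)
    (cases : ((2 < #|'I_n|)%N /\ #|Ic| = 1%N) \/
             (#|'I_n| = 2%N /\ (#|Ic| <= 1)%N))
    (J : set R) (x : R -> 'M[R]_(3, n))
    (x_sol : maximal_filippov_solution state_domain (attitude_field e f) J x)
    (x_init : forall i, enorm (col i (x 0)) < pi) :
  finite_time_consensus J x.
Proof.
have [n1 Ic1] : (1 < n)%N /\ (#|Ic| <= 1)%N.
  by case: cases; rewrite card_ord => -[nn ->]; split => //; [exact: ltnW|rewrite nn].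
have [T [JT T0 xT]] := maximal_solution_reaches_consensus f_cont f_sign e_sym e_irr
  e_conn n1 Ic1 x_sol x_init.
exists T; split => //; have [v xv] := xT; exists (rodrigues v).
  exact: rodrigues_SO3.
move=> i.
have [[_ _ xac _] _] := x_sol.
have xl := absolutely_continuous_cvg_left T0 (xac T JT).
have xil : (fun t => col i (x t)) @ T^'- --> v.
  apply: cvg_mx => k l; rewrite -(xv i) mxE; under eq_fun do rewrite mxE.
  refine (continuous_cvg _ (@continuous_entry _ _ _ k i (x T)) xl).
have -> : rotation x i = fun t => rodrigues (col i (x t)).
  by apply/funext => t; rewrite /rotation expmx_hat.
refine (@continuous_cvg _ _ _ _ _ _ (@rodrigues R) v (@cvg_rodrigues R v) xil).
Qed.
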